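(* Let $1\le q\le p\le\infty$ and $q\le r\le\infty$ with $\frac1q=\frac1p+\frac1r$. Then for all $n\in\mathbb N$ and all operators $T\in\mathcal L(X,Y)$ of rank $n$ between Banach spaces $X,Y$ one has $$\pi_{pq}(T)\le c_r\cdot\begin{cases}\pi_{pq}^{n}(T) & \text{for } 1\le r<2,\\ \pi_{pq}^{[n(1+\ln n)]}(T) & \text{for } r=2,\\ \pi_{pq}^{[n^{r/2}]}(T) & \text{for } 2<r<\infty,\end{cases}$$ where $c_r$ is a constant depending only on $r$.
   Context: $\mathcal L(X,Y)$ denotes the bounded linear operators between Banach spaces $X,Y$. For $1\le q\le p\le\infty$, $m\in\mathbb N$ and $T\in\mathcal L(X,Y)$, the $(p,q)$-summing norm of $T$ with respect to $m$ vectors is $$\pi_{pq}^m(T)=\sup\Big\{\Big(\sum_{k=1}^m\|Tx_k\|^p\Big)^{1/p}\ :\ x_1,\dots,x_m\in X,\ \sup_{\|x^*\|_{X^*}\le1}\Big(\sum_{k=1}^m|\langle x_k,x^*\rangle|^q\Big)^{1/q}\le1\Big\}$$ (with maxima replacing the sums when an exponent is $\infty$), and $\pi_{pq}(T)=\sup_m\pi_{pq}^m(T)$. $[x]$ denotes the integer part of $x$. *)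

(* Defs.v *)
From HB Require Import structures.
From mathcomp Require Import all_boot all_order all_algebra.
From mathcomp Require Import all_classical all_reals all_analysis.
From mathcomp Require Import complex.

Set Implicit Arguments.
Unset Strict Implicit.
Unset Printing Implicit Defensive.
Import Order.TTheory GRing.Theory Num.Theory.
Import numFieldNormedType.Exports.
Local Open Scope classical_set_scope.
Local Open Scope ring_scope.
Local Open Scope ereal_scope.

(* Banach spaces are taken over either the real or the complex field. *)
Variant scalars := RealScalars | ComplexScalars.

Definition scalar_field (R : realType) (F : scalars) : numFieldType :=
  match F with
  | RealScalars => R
  | ComplexScalars => (R[i])%C
  end.

Definition scalar_re (R : realType) (F : scalars) : scalar_field R F -> R :=
  match F return scalar_field R F -> R with
  | RealScalars => fun x => x
  | ComplexScalars => fun z => complex.Re z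
  end.

(* The norm of a normed module takes its values in the scalar field; over the
   complex field these values have imaginary part 0, so nothing is lost by
   taking real parts. *)
Definition rnorm (R : realType) (F : scalars)
    (V : normedModType (scalar_field R F)) (x : V) : R :=
  scalar_re (`|x|%R : scalar_field R F).

Definition op_norm (R : realType) (F : scalars)
    (U V : normedModType (scalar_field R F)) (f : {linear U -> V}) : \bar R :=
  ereal_sup [set (rnorm (f x))%:E | x in [set x : U | (rnorm x <= 1)%R]].

(* Only meant for exponents 1 <= p <= +oo and a family a of nonnegative reals;
   starting the maximum at 0 only matters when m = 0. *)
Definition lp_norm (R : realType) (p : \bar R) (m : nat) (a : 'I_m -> R) : R :=
  match p with
  | s%:E => ((\sum_(k < m) a k `^ s) `^ s^-1)%R
  | _ => \big[Num.max/0%R]_(k < m) a k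
  end.

(* The supremum over the closed unit ball of the dual of X: a linear functional
   of finite op_norm is automatically continuous. *)
Definition weak_lp_norm (R : realType) (F : scalars)
    (X : normedModType (scalar_field R F)) (q : \bar R) (m : nat)
    (x : 'I_m -> X) : \bar R :=
  ereal_sup [set (lp_norm q (fun k => rnorm (f (x k))))%:E |
    f in [set f : {linear X -> (scalar_field R F)^o} | op_norm f <= 1]].

Definition summing_norm_on (R : realType) (F : scalars)
    (X Y : normedModType (scalar_field R F)) (p q : \bar R) (m : nat)
    (T : {linear X -> Y}) : \bar R :=
  ereal_sup [set (lp_norm p (fun k => rnorm (T (x k))))%:E |
    x in [set x : 'I_m -> X | weak_lp_norm q x <= 1]].

Definition summing_norm (R : realType) (F : scalars)
    (X Y : normedModType (scalar_field R F)) (p q : \bar R)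
    (T : {linear X -> Y}) : \bar R :=
  ereal_sup [set summing_norm_on p q m T | m in [set: nat]].

Definition has_rank (K : numFieldType) (X Y : lmodType K)
    (T : {linear X -> Y}) (n : nat) : Prop :=
  exists e : 'I_n -> Y,
    (forall a : 'I_n -> K,
        (\sum_(i < n) a i *: e i = 0)%R -> forall i, a i = 0%R) /\
    range T = [set (\sum_(i < n) a i *: e i)%R | a in [set: 'I_n -> K]].

(* Main.v *)
(* By Hoelder, everything reduces to the exponents (s, 1) with 1/s = 1 - 1/r, and
   then to a seminorm nu on R^N vanishing on a subspace of codimension D = 2n (T has
   real rank at most 2n): if sum_j nu(f_j)^s <= 1 for all families of M vectors with
   sum_j |f_j| <= 1, one must bound sum_k nu(e_k)^s. Pisier's extremal argument gives
   a probability lambda with nu(g)^s <= 2/M + s lambda(|g|) for |g| <= 1. This bounds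
   nu(e_k)^s when lambda_k > 1/M; the other k contribute at most a constant times
   M^(-1/r) alpha, where alpha = sum_k nu(e_k). To bound alpha, use the density
   theta = D (nu(e_k)/alpha + lambda): in the Hilbert norm it defines, only the
   orthogonal projection onto a space of dimension D matters, while the operator norm
   of nu is controlled by truncation and a dyadic decomposition. This yields
   alpha <= c (D sum_(i < L) 2^(i (r - 2)))^(1/r) + c D^(1/2), with 4^L about D,
   and this is O(M^(1/r)) exactly for the numbers M of the theorem. *)
Require Import Defs.
From HB Require Import structures.
From mathcomp Require Import all_boot all_order all_algebra.
From mathcomp Require Import all_classical all_reals all_analysis.
From mathcomp Require Import complex ring lra zify.
Set Implicit Arguments.
Unset Strict Implicit.
Unset Printing Implicit Defensive.
Import Order.TTheory GRing.Theory Num.Theory.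
Import numFieldNormedType.Exports.
Local Open Scope classical_set_scope.
Local Open Scope ring_scope.

(** * Inequalities and supporting functionals *)

Lemma young_powR (R : realType) (a b x y : R) :
  0 < a -> 0 < b -> a + b = 1 -> 0 <= x -> 0 <= y ->
  x `^ a * y `^ b <= a * x + b * y.
Proof.
move=> a0 b0 ab x0 y0.
have := @conjugate_powR R (x `^ a) (y `^ b) a^-1 b^-1.
rewrite !powR_ge0 !invr_gt0 !invrK -!powRrM !divff ?gt_eqF//.
by rewrite !powRr1// (mulrC x) (mulrC y); exact.
Qed.

Lemma holder_sum (R : realType) (I : finType) (a b : R) (u v : I -> R) :
  0 <= a -> 0 <= b -> a + b = 1 ->
  (forall i, 0 <= u i) -> (forall i, 0 <= v i) ->
  \sum_i u i `^ a * v i `^ b <= (\sum_i u i) `^ a * (\sum_i v i) `^ b.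
Proof.
move=> a0 b0 ab u0 v0.
have U0 : 0 <= \sum_i u i by apply: sumr_ge0.
have V0 : 0 <= \sum_i v i by apply: sumr_ge0.
have [az|an] := eqVneq a 0.
  have -> : b = 1 by rewrite -ab az add0r.
  rewrite az powRr0 mul1r powRr1//.
  by apply: ler_sum => i _; rewrite powRr0 mul1r powRr1.
have [bz|bn] := eqVneq b 0.
  have -> : a = 1 by rewrite -ab bz addr0.
  rewrite bz powRr0 mulr1 powRr1//.
  by apply: ler_sum => i _; rewrite powRr0 mulr1 powRr1.
have ap : 0 < a by rewrite lt_neqAle eq_sym an.
have bp : 0 < b by rewrite lt_neqAle eq_sym bn.
have [Uz|Un] := eqVneq (\sum_i u i) 0.
  rewrite Uz powR0// mul0r big1// => i _.
  move/eqP: Uz; rewrite psumr_eq0// => /allP/(_ i (mem_index_enum _))/eqP ->.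
  by rewrite powR0// mul0r.
have [Vz|Vn] := eqVneq (\sum_i v i) 0.
  rewrite Vz powR0// mulr0 big1// => i _.
  move/eqP: Vz; rewrite psumr_eq0// => /allP/(_ i (mem_index_enum _))/eqP ->.
  by rewrite powR0// mulr0.
set U := \sum_i u i in U0 Un *; set V := \sum_i v i in V0 Vn *.
have Up : 0 < U by rewrite lt_neqAle eq_sym Un.
have Vp : 0 < V by rewrite lt_neqAle eq_sym Vn.
have step i : u i `^ a * v i `^ b <=
    U `^ a * V `^ b * (a * (u i / U) + b * (v i / V)).
  have -> : u i `^ a * v i `^ b =
      U `^ a * V `^ b * ((u i / U) `^ a * (v i / V) `^ b).
    rewrite mulrACA -!powRM ?divr_ge0//.
    by rewrite !(mulrC _ (_ / _)) !divfK.
  rewrite ler_wpM2l ?mulr_ge0 ?powR_ge0//.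
  by rewrite young_powR ?divr_ge0.
apply: (le_trans (ler_sum _ (fun i _ => step i))).
rewrite -mulr_sumr big_split/= -!mulr_sumr -!mulr_suml -/U -/V !divff//.
by rewrite !mulr1 ab mulr1.
Qed.

(** Convexity of y -> y^s: the graph lies above the tangent at x. This is Young's inequality with
    weights (s - 1)/s and 1/s. *)
Lemma powR_tangent (R : realType) (s x y : R) : 1 < s -> 0 <= x -> 0 <= y ->
  s * (x `^ (s - 1) * y) <= (s - 1) * x `^ s + y `^ s.
Proof.
move=> s1 x0 y0; have s0 : 0 < s by apply: lt_trans s1.
have := @young_powR R ((s - 1) / s) s^-1 (x `^ s) (y `^ s).
rewrite divr_gt0 ?subr_gt0// invr_gt0 s0 !powR_ge0 -!powRrM divff ?gt_eqF//.
rewrite powRr1// mulrCA divff ?gt_eqF// mulr1.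
have -> : (s - 1) / s + s^-1 = 1 by field; rewrite gt_eqF.
move=> /(_ isT isT erefl isT isT) h.
rewrite -ler_pdivlMl//; apply: le_trans h _.
by rewrite le_eqVlt; apply/orP; left; apply/eqP; field; rewrite gt_eqF.
Qed.

Lemma powR_sub_le (R : realType) (s x y : R) : 1 < s -> 0 <= x -> 0 <= y ->
  x `^ s - y `^ s <= s * (x `^ (s - 1) * (x - y)).
Proof.
move=> s1 x0 y0; have := powR_tangent s1 x0 y0.
have -> : x `^ s = x `^ (s - 1) * x.
  by rewrite mulrC mulr_powRB1// (lt_trans _ s1).
by lra.
Qed.

Definition sublinear (R : realType) (V : lmodType R) (nu : V -> R) : Prop :=
  (forall x y, nu (x + y) <= nu x + nu y) /\
  (forall t x, 0 <= t -> nu (t *: x) = t * nu x).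

(** One step of Hahn-Banach by an explicit formula: mu(x) is the infimum of nu(x + t v) - t nu(v)
    over t >= 0. The value t = 0 gives mu <= nu and t = 1 the bound at -v; together they make mu
    linear along v. *)
Lemma sublinear_along (R : realType) (V : lmodType R) (nu : V -> R) (v : V) :
  sublinear nu -> exists mu : V -> R,
    [/\ sublinear mu, forall x, mu x <= nu x & mu (- v) <= - nu v].
Proof.
move=> [nuD nuZ].
have nu0 : nu 0 = 0 by have := nuZ 0 0 (lexx _); rewrite scale0r mul0r.
pose E x := [set nu (x + t *: v) - t * nu v | t in [set t | 0 <= t]].
(* The infimum is finite because t nu(v) = nu(t v) <= nu(x + t v) + nu(-x). *)
have Elb x : lbound (E x) (- nu (- x)).
  move=> _ [t t0 <-]; rewrite lerBrDr -nuZ//.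
  rewrite addrC lerBlDr.
  by have := nuD (x + t *: v) (- x); rewrite addrAC subrr add0r.
have Ehas x : has_inf (E x).
  by split; [exists (nu (x + 0 *: v) - 0 * nu v); exists 0 => //=|
    exists (- nu (- x))].
have Ele x t : 0 <= t -> inf (E x) <= nu (x + t *: v) - t * nu v.
  by move=> t0; apply: ge_inf; [case: (Ehas x)|exists t].
exists (fun x => inf (E x)); split.
- split.
    move=> x y /=; rewrite -lerBlDr; apply: lb_le_inf; first by case: (Ehas x).
    move=> _ [t /= t0 <-]; rewrite lerBlDr -lerBlDl.
    apply: lb_le_inf; first by case: (Ehas y).
    move=> _ [w /= w0 <-]; rewrite lerBlDr.
    apply: (le_trans (Ele _ (t + w) (addr_ge0 t0 w0))).
    have := nuD (x + t *: v) (y + w *: v).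
    rewrite addrACA -scalerDl; lra.
  move=> t x /=; rewrite le_eqVlt => /predU1P[<-|t0].
    rewrite scale0r mul0r; apply/le_anti/andP; split.
      by have := Ele 0 0 (lexx _); rewrite scale0r addr0 nu0 mul0r subrr.
    apply: lb_le_inf; first by case: (Ehas 0).
    by move=> _ [w /= w0 <-]; rewrite add0r nuZ// subrr.
  apply/le_anti/andP; split.
    rewrite -ler_pdivrMl//; apply: lb_le_inf; first by case: (Ehas x).
    move=> _ [w /= w0 <-]; rewrite ler_pdivrMl//.
    apply: (le_trans (Ele _ (t * w) _)); first by rewrite mulr_ge0// ltW.
    by rewrite -scalerA -scalerDr (nuZ t) ?(ltW t0)// mulrBr mulrA.
  apply: lb_le_inf; first by case: (Ehas (t *: x)).
  move=> _ [w /= w0 <-]; rewrite -ler_pdivlMl//.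
  apply: (le_trans (Ele _ (t^-1 * w) _)).
    by rewrite mulr_ge0// invr_ge0 ltW.
  rewrite mulrBr -(nuZ t^-1 (_ + _)) ?invr_ge0 ?(ltW t0)// scalerDr !scalerA mulVf ?gt_eqF//.
  by rewrite scale1r mulrA.
- by move=> x; have := Ele x 0 (lexx _); rewrite scale0r addr0 mul0r subr0.
- have := Ele (- v) 1 ler01.
  by rewrite scale1r addNr nu0 mul1r sub0r.
Qed.

(** Each step only lowers the functional, so ga(-w) <= mu(-w) <= -mu(w) <= -ga(w) preserves
    linearity along the earlier directions. *)
Lemma sublinear_along_seq (R : realType) (V : lmodType R) (nu : V -> R)
    (vs : seq V) :
  sublinear nu -> exists mu : V -> R,
    [/\ sublinear mu, forall x, mu x <= nu x &
        forall v, v \in vs -> mu (- v) <= - mu v].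
Proof.
move=> nuS; elim: vs => [|v vs [mu [muS mule muN]]]; first by exists nu; split.
have [ga [gaS gale gaN]] := sublinear_along v muS.
exists ga; split => // [x|w]; first exact: le_trans (mule x).
rewrite inE => /predU1P[->|wvs].
  by apply: le_trans gaN _; rewrite lerN2.
by apply: (le_trans (gale _)); apply: (le_trans (muN _ wvs)); rewrite lerN2.
Qed.

(** Linearity along x0 comes first and fixes the value nu(x0). Linearity along all unit vectors then
    turns the sublinear functional into a linear form, whose coefficients are its values at the unit
    vectors. *)
Lemma support_functional (R : realType) (N : nat) (nu : 'rV[R]_N -> R)
    (x0 : 'rV[R]_N) :
  sublinear nu -> exists l : 'I_N -> R,
    (forall x : 'rV[R]_N, \sum_k x 0 k * l k <= nu x) /\ \sum_k x0 0 k * l k = nu x0.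
Proof.
move=> nuS; have [mu [muS mule muN]] := sublinear_along x0 nuS.
have [ga [[gaD gaZ] gale gaN]] :=
  sublinear_along_seq [seq (delta_mx 0 k : 'rV[R]_N) | k <- enum 'I_N] muS.
pose l k := ga (delta_mx 0 k).
have ga0 : ga 0 = 0 by have := gaZ 0 0 (lexx _); rewrite scale0r mul0r.
have gaNN x : - ga (- x) <= ga x.
  by have := gaD x (- x); rewrite subrr ga0; lra.
have gaC t k : ga (t *: delta_mx 0 k) <= t * l k.
  have [t0|t0] := leP 0 t; first by rewrite gaZ.
  have -> : t *: delta_mx 0 k = (- t) *: - (delta_mx 0 k : 'rV[R]_N).
    by rewrite scalerN scaleNr opprK.
  have : ga (- delta_mx 0 k) <= - l k.
    by apply: gaN; apply/mapP; exists k; rewrite ?mem_enum.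
  have t1 : 0 <= - t by rewrite oppr_ge0 ltW.
  by rewrite (gaZ (- t))// => /(ler_wpM2l t1); rewrite mulrNN.
have le1 (x : 'rV[R]_N) : ga x <= \sum_k x 0 k * l k.
  rewrite {1}(row_sum_delta x).
  elim/big_ind2 : _ => [|y a z b ya zb|k _]; first by rewrite ga0.
    by apply: le_trans (gaD _ _) _; rewrite lerD.
  exact: gaC.
have le2 (x : 'rV[R]_N) : \sum_k x 0 k * l k <= ga x.
  apply: le_trans (gaNN x); rewrite lerNr; apply: le_trans (le1 _) _.
  rewrite -sumrN; apply: ler_sum => k _.
  by rewrite mxE mulNr.
have eqg (x : 'rV[R]_N) : \sum_k x 0 k * l k = ga x by apply/le_anti; rewrite le1 le2.
exists l; split=> [x|]; first exact: le_trans (le2 x) (le_trans (gale x) (mule x)).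
apply/le_anti/andP; split.
  exact: le_trans (le2 _) (le_trans (gale _) (mule _)).
have := le_trans (gale (- x0)) muN; rewrite -eqg eqg.
by have := gaNN x0; rewrite eqg; lra.
Qed.

(** * Pisier's extremal argument *)

Definition seminorm (R : realType) (V : lmodType R) (nu : V -> R) : Prop :=
  (forall x y, nu (x + y) <= nu x + nu y) /\
  (forall t x, nu (t *: x) = `|t| * nu x).

Lemma seminorm_sublinear (R : realType) (V : lmodType R) (nu : V -> R) :
  seminorm nu -> sublinear nu.
Proof. by move=> [nuD nuZ]; split=> // t x t0; rewrite nuZ ger0_norm. Qed.

Lemma seminorm0 (R : realType) (V : lmodType R) (nu : V -> R) :
  seminorm nu -> nu 0 = 0.
Proof. by move=> [_ /(_ 0 0)]; rewrite scale0r normr0 mul0r. Qed.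

Lemma seminorm_ge0 (R : realType) (V : lmodType R) (nu : V -> R) x :
  seminorm nu -> 0 <= nu x.
Proof.
move=> nuS; have [nuD nuZ] := nuS.
have := nuD x (- x); rewrite subrr seminorm0//.
have -> : nu (- x) = nu x by rewrite -scaleN1r nuZ normrN1 mul1r.
by lra.
Qed.

Lemma seminorm_sum (R : realType) (V : lmodType R) (nu : V -> R)
    (I : finType) (F : I -> V) :
  seminorm nu -> nu (\sum_i F i) <= \sum_i nu (F i).
Proof.
move=> nuS; elim/big_ind2 : _ => [|x a y b xa yb|//].
  by rewrite seminorm0.
by apply: le_trans (nuS.1 _ _) _; rewrite lerD.
Qed.

(** The families of weak l_1 norm at most 1 in R^N with the maximum norm. *)
Definition abs_sums_le1 (R : realType) (m N : nat) (f : 'I_m -> 'rV[R]_N) :=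
  forall k, \sum_j `|f j 0 k| <= 1.

(* Maximal families behave well under perturbation: f, replaced by f(1 - |g|),
   leaves room for g, and a supporting functional at each member of f bounds
   what is lost. Among the sizes m < M there is one where the supremum grows by
   at most 1/M. *)
Lemma pisier_measure (R : realType) (s : R) (M N : nat)
    (nu : 'rV[R]_N -> R) :
  1 < s -> (0 < M)%N -> seminorm nu ->
  (forall f : 'I_M -> 'rV[R]_N, abs_sums_le1 f ->
     \sum_j nu (f j) `^ s <= 1) ->
  exists lam : 'I_N -> R, [/\ forall k, 0 <= lam k, \sum_k lam k <= 1 &
    forall g : 'rV[R]_N, (forall k, `|g 0 k| <= 1) ->
      nu g `^ s <= 2 / M%:R + s * \sum_k lam k * `|g 0 k|].
Proof.
move=> s1 M0 nuS nuM.
have s0 : 0 < s by apply: lt_trans s1.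
have nu_ge0 x : 0 <= nu x by apply: seminorm_ge0.
pose ok (m : nat) (f : nat -> 'rV[R]_N) :=
  forall k, \sum_(j < m) `|f j 0 k| <= 1.
pose E m := [set \sum_(j < m) nu (f j) `^ s | f in [set f | ok m f]].
have Eub m : (m <= M)%N -> ubound (E m) 1.
  move=> mM _ [f /= fok <-].
  (* Padding by zeros turns m vectors into M. *)
  have := nuM (fun j : 'I_M => if (j < m)%N then f j else 0).
  have -> : \sum_(j < m) nu (f j) `^ s =
      \sum_(j < M) nu (if (j < m)%N then f j else 0) `^ s.
    rewrite (big_ord_widen _ (fun j => nu (f j) `^ s) mM) big_mkcond/=.
    by apply: eq_bigr => j _; case: ifP; rewrite // seminorm0// powR0// gt_eqF.
  apply=> k; apply: le_trans (fok k).
  rewrite (big_ord_widen _ (fun j => `|f j 0 k|) mM) [leRHS]big_mkcond/=.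
  by apply: ler_sum => j _; case: ifP; rewrite // mxE normr0.
have Ene m : E m !=set0.
  exists (\sum_(j < m) nu ((fun=> 0) j) `^ s); exists (fun=> 0) => //= k.
  by rewrite big1// => j _; rewrite mxE normr0.
have Ehas m : (m <= M)%N -> has_sup (E m).
  by move=> mM; split => //; exists 1; apply: Eub.
pose Phi m := sup (E m).
(* Otherwise each of the M steps from [Phi 0] >= 0 adds more than 1/M, and [Phi M] > 1. *)
have [m mM Phim] : exists2 m, (m < M)%N & Phi m.+1 <= Phi m + M%:R^-1.
  apply: contrapT => noM.
  have grow m : (m < M)%N -> Phi m + M%:R^-1 < Phi m.+1.
    by move=> mM; rewrite ltNge; apply/negP => h; apply: noM; exists m.
  have lin m : (m < M)%N -> m.+1%:R / M%:R < Phi m.+1.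
    elim: m => [|m IH] mM.
      apply: le_lt_trans (grow _ mM); rewrite div1r lerDr.
      have [x Ex] := Ene 0; have := ub_le_sup (Ehas 0 isT).2 Ex.
      by case: Ex => f _ <-; rewrite big_ord0.
    apply: le_lt_trans (grow _ mM).
    by rewrite -natr1 mulrDl div1r lerD2r ltW// IH// ltnW.
  have := lin M.-1; rewrite prednK// leqnn => /(_ isT).
  rewrite divff ?pnatr_eq0 -?lt0n// ltNge => /negP; apply.
  by apply: ge_sup; [exact: Ene|exact: Eub].
(* The growth of [Phi] and the defect of [f] cost 1/M each; this is the 2/M of the conclusion. *)
have M1 : 0 < M%:R^-1 :> R by rewrite invr_gt0 ltr0n.
have [_ [f fok <-] fsup] := sup_adherent M1 (Ehas m (ltnW mM)).
rewrite -/(Phi m) in fsup.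
have /choice[l lP] : forall j, exists l : 'I_N -> R,
    (forall x : 'rV[R]_N, \sum_k x 0 k * l k <= nu x) /\
    \sum_k f j 0 k * l k = nu (f j).
  by move=> j; apply: support_functional; exact: seminorm_sublinear.
(* s [lam] plays the role of the gradient at u = 1 of u -> sum_j nu(u f_j)^s, with nu replaced near
   f_j by its supporting functional [l j]. *)
pose lam k := \sum_(j < m) nu (f j) `^ (s - 1) * (f j 0 k * l j k).
have lamE (u : 'I_N -> R) : \sum_k lam k * u k =
    \sum_(j < m) nu (f j) `^ (s - 1) * \sum_k (f j 0 k * u k) * l j k.
  under eq_bigr do rewrite mulr_suml.
  rewrite exchange_big/=; apply: eq_bigr => j _.
  by rewrite mulr_sumr; apply: eq_bigr => k _; ring.
exists (fun k => `|lam k|); split => // [|g g1].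
(* Multiplying f by the signs of [lam] keeps the family admissible, and the tangent inequality
   bounds s sum_k |lam_k| by (s - 1) + 1. *)
- have -> : \sum_k `|lam k| = \sum_k lam k * Num.sg (lam k).
    by apply: eq_bigr => k _; rewrite [LHS]normrEsg mulrC.
  rewrite lamE.
  pose h j : 'rV[R]_N := \row_k (f j 0 k * Num.sg (lam k)).
  have hok : ok m h.
    move=> k; apply: le_trans (fok k); apply: ler_sum => j _.
    by rewrite mxE normrM ler_piMr// normr_sg lern1 leq_b1.
  have hE j : \sum_k (f j 0 k * Num.sg (lam k)) * l j k <= nu (h j).
    apply: le_trans ((lP j).1 (h j)).
    by apply: ler_sum => k _; rewrite mxE.
  rewrite -(ler_pM2l s0) mulr1 mulr_sumr.
  have := Eub m (ltnW mM).
  move=> ubE; have ubf := ubE _ (ex_intro2 _ _ f fok erefl).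
  have ubh := ubE _ (ex_intro2 _ _ h hok erefl).
  have key : \sum_(j < m) s * (nu (f j) `^ (s - 1) *
        \sum_k (f j 0 k * Num.sg (lam k)) * l j k) <=
      (s - 1) * (\sum_(j < m) nu (f j) `^ s) + \sum_(j < m) nu (h j) `^ s.
    rewrite mulr_sumr -big_split/=; apply: ler_sum => j _.
    apply: le_trans (powR_tangent s1 (nu_ge0 _) (nu_ge0 _)).
    by rewrite ler_pM2l// ler_wpM2l ?powR_ge0.
  apply: le_trans key _; move: ubf ubh => /= ubf ubh.
  apply: (@le_trans _ _ ((s - 1) * 1 + 1)); last by lra.
  by apply: lerD => //; rewrite ler_wpM2l// subr_ge0 ltW.
- pose h j : 'rV[R]_N :=
    if (j < m)%N then \row_k (f j 0 k * (1 - `|g 0 k|)) else g.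
  have hok : ok m.+1 h.
    move=> k; rewrite big_ord_recr/= /h ltnn.
    under eq_bigr => j _ do
      rewrite (ltn_ord j) mxE normrM [X in _ * X]ger0_norm ?subr_ge0//.
    rewrite -mulr_suml -lerBrDr ler_piMl// subr_ge0//.
  have := ub_le_sup (Ehas _ mM).2 (ex_intro2 _ _ h hok erefl).
  rewrite -/(Phi _) big_ord_recr/= {2}/h ltnn => supPhi.
  have hj j : (j < m)%N -> nu (f j) `^ s - nu (h j) `^ s <=
      s * (nu (f j) `^ (s - 1) * \sum_k (f j 0 k * `|g 0 k|) * l j k).
    move=> jm; apply: le_trans (powR_sub_le s1 (nu_ge0 _) (nu_ge0 _)) _.
    rewrite ler_pM2l// ler_wpM2l ?powR_ge0// lerBlDr -lerBlDl.
    apply: le_trans ((lP j).1 (h j)); rewrite -(lP j).2 -sumrB.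
    by apply: ler_sum => k _; rewrite /h jm mxE; lra.
  have : \sum_(j < m) (nu (f j) `^ s - nu (h j) `^ s) <=
      s * \sum_k lam k * `|g 0 k|.
    by rewrite lamE mulr_sumr; apply: ler_sum => j _; exact: hj.
  rewrite sumrB => hsum.
  have : s * \sum_k lam k * `|g 0 k| <= s * \sum_k `|lam k| * `|g 0 k|.
    by rewrite ler_pM2l//; apply: ler_sum => k _; rewrite ler_wpM2r// ler_norm.
  move: (s * \sum_k lam k * `|g 0 k|) (s * \sum_k `|lam k| * `|g 0 k|) hsum.
  by move=> a b; lra.
Qed.

(** * The sum of the values at the unit vectors *)

(** Write B = C E with C of full column rank and take P = C (C^T C)^-1 C^T. By cyclicity its trace
    is the number of columns of C, the rank of B. *)
Lemma orthogonal_projection (R : realFieldType) (N D : nat) (B : 'M[R]_(N, D)) :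
  exists P : 'M[R]_N, [/\ P^T = P, P *m P = P, P *m B = B & \tr P <= D%:R].
Proof.
have [n [C [E [CE CT nD]]]] : exists n (C : 'M[R]_(N, n)) (E : 'M[R]_(n, D)),
    [/\ C *m E = B, row_free C^T & (n <= D)%N].
  exists (\rank B), (col_base B), (row_base B); split.
  - exact: mulmx_base.
  - by rewrite /row_free mxrank_tr; have := col_base_full B.
  - exact: rank_leq_col.
have [G GE] : exists G, G = C^T *m C by exists (C^T *m C).
have sqr0 m (v : 'rV[R]_m) : v *m v^T = 0 -> v = 0.
  move=> /matrixP/(_ 0 0); rewrite !mxE => /eqP.
  under eq_bigr do rewrite mxE -expr2.
  rewrite psumr_eq0 => [/allP v0|i _]; last exact: sqr_ge0.
  apply/rowP => i; rewrite mxE; apply/eqP.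
  by have := v0 i (mem_index_enum _); rewrite sqrf_eq0.
have Gu : G \in unitmx.
  rewrite -row_free_unit; apply: inj_row_free => v vG.
  have : v *m C^T == 0.
    apply/eqP/sqr0; rewrite (trmx_mul v) trmxK mulmxA -(mulmxA v) -GE vG.
    by rewrite mul0mx.
  by rewrite mulmx_free_eq0// => /eqP.
have GT : G^T = G by rewrite GE trmx_mul trmxK.
exists (C *m invmx G *m C^T); split.
- by rewrite (trmx_mul _ C^T) (trmx_mul C) trmxK trmx_inv GT mulmxA.
- rewrite !mulmxA -(mulmxA _ C^T C) -GE.
  by rewrite -(mulmxA _ (invmx G) G) mulVmx// mulmx1.
- rewrite -CE !mulmxA -(mulmxA _ C^T C) -GE.
  by rewrite -(mulmxA _ (invmx G) G) mulVmx// mulmx1.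
- by rewrite mxtrace_mulC mulmxA -GE mulmxV// mxtrace1 ler_nat.
Qed.

Lemma geometric_half_sum (R : realType) (L : nat) :
  \sum_(i < L) 2^-1 ^+ i <= 2 :> R.
Proof.
have -> : \sum_(i < L) 2^-1 ^+ i = 2 - 2 * 2^-1 ^+ L :> R.
  elim: L => [|L IH]; first by rewrite big_ord0 expr0; ring.
  by rewrite big_ord_recr/= IH exprS; field.
by rewrite gerBl mulr_ge0// exprn_ge0.
Qed.

(* A dyadic decomposition of g; a piece of size about 2^-i, rescaled to size 1,
   is estimated by [pisier_measure], and the pieces are summed by Hoelder. *)
Lemma seminorm_level_bound (R : realType) (s r e : R) (N L : nat)
    (nu : 'rV[R]_N -> R) (lam : 'I_N -> R) (g : 'rV[R]_N) :
  1 < s -> 1 < r -> s^-1 + r^-1 = 1 -> 0 <= e -> seminorm nu ->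
  (forall k, 0 <= lam k) ->
  (forall g : 'rV[R]_N, (forall k, `|g 0 k| <= 1) ->
     nu g `^ s <= e + s * \sum_k lam k * `|g 0 k|) ->
  (forall g : 'rV[R]_N, (forall k, `|g 0 k| <= 1) -> nu g <= 1) ->
  (forall k, `|g 0 k| <= 1) ->
  nu g <= (2 * e + 2 * s * \sum_k lam k * g 0 k ^+ 2) `^ s^-1 *
          (\sum_(i < L) 2 `^ (i%:R * (r - 2))) `^ r^-1 + 2^-1 ^+ L.
Proof.
move=> s1 r1 sr e0 nuS lam0 nuP nu1 g1.
have s0 : 0 < s by apply: lt_trans s1.
have r0 : 0 < r by apply: lt_trans r1.
have [nuD nuZ] := nuS; have nu_ge0 x : 0 <= nu x by apply: seminorm_ge0.
pose w (i : nat) : R := 2^-1 ^+ i.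
have w0 i : 0 < w i by rewrite exprn_gt0.
have wS i : w i.+1 = w i / 2 by rewrite /w exprS mulrC.
have wle i : w i.+1 <= w i by have := w0 i; rewrite wS; lra.
pose t i : 'rV[R]_N := \row_k if `|g 0 k| <= w i then g 0 k else 0.
pose u i : 'rV[R]_N := \row_k if w i.+1 < `|g 0 k| <= w i then g 0 k else 0.
have tE i : t i = u i + t i.+1.
  apply/rowP => k; rewrite !mxE; have [h|h] := leP `|g 0 k| (w i.+1) => /=.
    by rewrite (le_trans h (wle i)) add0r.
  by case: ifP => _; rewrite addr0.
have t0 : t 0 = g by apply/rowP => k; rewrite mxE /w expr0 g1.
have tL : nu g <= \sum_(i < L) nu (u i) + nu (t L).
  rewrite -t0; elim: (L) => [|n IH]; first by rewrite big_ord0 add0r.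
  rewrite big_ord_recr/= -addrA; apply: (le_trans IH); rewrite lerD2l tE.
  exact: nuD.
have scale i (x : 'rV[R]_N) : nu x = w i * nu ((w i)^-1 *: x).
  rewrite nuZ ger0_norm ?invr_ge0 ?ltW// mulrA divff ?mul1r//.
  by rewrite gt_eqF.
have ule i k : `|((w i)^-1 *: u i) 0 k| <= 1.
  rewrite mxE normrM normfV (gtr0_norm (w0 i)) ler_pdivrMl// mulr1 mxE.
  by case: ifP => [/andP[]//|_]; rewrite normr0 ltW.
apply: (le_trans tL); apply: lerD; last first.
  rewrite (scale L) -[leRHS]mulr1 ler_wpM2l ?(ltW (w0 L))//; apply: nu1 => k.
  rewrite mxE normrM normfV (gtr0_norm (w0 L)) ler_pdivrMl// mulr1 mxE.
  by case: ifP => // _; rewrite normr0 ltW.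
pose x i := nu ((w i)^-1 *: u i).
have x0 i : 0 <= x i by exact: nu_ge0.
have wp i : w i = 2 `^ (- i%:R) by rewrite powRN powR_mulrn// /w exprVn.
(* The weight w_i^2 is chosen with [step] in view: on the support of [u i] one has w_i |u_i| <= 2
   u_i^2. The second factor takes up the remaining power of w_i, by 1/s + 1/r = 1. *)
have -> : \sum_(i < L) nu (u i) =
    \sum_(i < L) (w i ^+ 2 * x i `^ s) `^ s^-1 * (2 `^ (i%:R * (r - 2))) `^ r^-1.
  apply: eq_bigr => i _; rewrite (scale i) -/(x i).
  rewrite powRM ?sqr_ge0 ?powR_ge0// -powRrM divff ?gt_eqF// powRr1//.
  rewrite mulrAC; congr (_ * _).
  rewrite -powR_mulrn ?(ltW (w0 i))// wp -!powRrM -powRD; last first.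
    by rewrite pnatr_eq0 implybT.
  congr powR; have -> : s^-1 = 1 - r^-1 by rewrite -sr addrK.
  by field; rewrite gt_eqF.
have si0 : 0 <= s^-1 by rewrite invr_ge0 ltW.
have ri0 : 0 <= r^-1 by rewrite invr_ge0 ltW.
apply: (le_trans (holder_sum si0 ri0 sr _ _)).
- by move=> i; rewrite mulr_ge0 ?powR_ge0 ?sqr_ge0.
- by move=> i; rewrite powR_ge0.
rewrite ler_wpM2r ?powR_ge0//.
have lg0 : 0 <= \sum_k lam k * g 0 k ^+ 2.
  by apply: sumr_ge0 => k _; rewrite mulr_ge0 ?sqr_ge0.
rewrite ge0_ler_powR ?invr_ge0 ?nnegrE ?(ltW s0)//.
- by apply: sumr_ge0 => i _; rewrite mulr_ge0 ?powR_ge0 ?sqr_ge0.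
- by rewrite addr_ge0// mulr_ge0// mulr_ge0// ltW.
have step (i : nat) : w i ^+ 2 * x i `^ s <=
    w i * e + 2 * s * \sum_k lam k * u i 0 k ^+ 2.
  have wi1 : w i <= 1 by rewrite exprn_ile1//; lra.
  apply: (@le_trans _ _ (w i ^+ 2 *
      (e + s * \sum_k lam k * `|((w i)^-1 *: u i) 0 k|))).
    by rewrite ler_wpM2l ?sqr_ge0//; apply: nuP => k; exact: ule.
  rewrite mulrDr; apply: lerD.
    by rewrite ler_wpM2r// expr2 ler_piMr// ltW// w0.
  rewrite mulrCA (mulrC 2 s) -(mulrA s 2) ler_pM2l// !mulr_sumr.
  apply: ler_sum => k _.
  rewrite mulrCA [leRHS]mulrCA ler_wpM2l// mxE normrM normfV (gtr0_norm (w0 i)).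
  have -> : w i ^+ 2 * ((w i)^-1 * `|u i 0 k|) = w i * `|u i 0 k|.
    by field; rewrite gt_eqF.
  rewrite mxE; case: ifP => [/andP[h _]|_]; last first.
    by rewrite normr0 mulr0 expr0n mulr0.
  rewrite -real_normK ?num_real//; have := normr_ge0 (g 0 k).
  by move: h; rewrite wS; nra.
apply: (le_trans (ler_sum _ (fun (i : 'I_L) _ => step i))).
rewrite big_split/= -mulr_suml; apply: lerD.
  by rewrite ler_wpM2r// geometric_half_sum.
rewrite -mulr_sumr ler_wpM2l ?mulr_ge0 ?(ltW s0)//.
rewrite exchange_big/=; apply: ler_sum => k _.
rewrite -mulr_sumr ler_wpM2l//.
have -> : g 0 k = t 0 0 k by rewrite t0.
(* The pieces have disjoint supports; keeping the remainder [t n] makes the induction work. *)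
suff h n : \sum_(i < n) u i 0 k ^+ 2 + t n 0 k ^+ 2 <= t 0 0 k ^+ 2.
  by apply: le_trans (h L); rewrite lerDl sqr_ge0.
elim: n => [|n IH]; first by rewrite big_ord0 add0r.
apply: le_trans IH; rewrite big_ord_recr/= -addrA lerD2l.
rewrite !mxE; have [h|h] := leP `|g 0 k| (w n.+1) => /=.
  by rewrite (le_trans h (wle n)) expr0n add0r.
by rewrite [0 ^+ 2]expr0n addr0.
Qed.

(** Rescaled by [d], nu is a seminorm on Euclidean space of norm at most [op], and it factors
    through a projection P of trace at most D. Hence a_k <= op sqrt(th_k P_kk), and summation gives
    al <= op 3D/2 = al/2 + 9 D b/2. *)
Lemma sum_seminorm_bound (R : realType) (b : R) (N D : nat)
    (nu : 'rV[R]_N -> R) (A : 'M[R]_(N, D)) (lam : 'I_N -> R) :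
  (0 < D)%N -> seminorm nu ->
  (forall x, x *m A = 0 -> nu x = 0) ->
  (forall k, 0 <= lam k) -> \sum_k lam k <= 1 ->
  (forall g : 'rV[R]_N, (forall k, `|g 0 k| <= 1) ->
     \sum_k lam k * g 0 k ^+ 2 <= D%:R^-1 -> nu g <= b) ->
  \sum_k nu (delta_mx 0 k) <= 9 * D%:R * b.
Proof.
move=> D0 nuS nuA lam0 lam1 nub.
have [nuD nuZ] := nuS; have nu_ge0 x : 0 <= nu x by apply: seminorm_ge0.
have Dp : 0 < D%:R :> R by rewrite ltr0n.
have b0 : 0 <= b.
  apply: le_trans (nub 0 _ _) => // [k|]; first by rewrite mxE normr0.
  by rewrite big1 ?invr_ge0 ?ltW// => k _; rewrite mxE expr0n mulr0.
set a := fun k => nu (delta_mx 0 k); rewrite -/(\sum_k a k).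
have a0 k : 0 <= a k by exact: nu_ge0.
pose al := \sum_k a k.
have al0 : 0 <= al by apply: sumr_ge0 => k _; exact: nu_ge0.
have [alz|aln] := eqVneq al 0.
  by rewrite -/al alz; rewrite mulr_ge0// mulr_ge0// ltW.
have alp : 0 < al by rewrite lt_neqAle eq_sym aln.
(* A density of mass at most 2D. Its first summand serves [d2a], its second [d2lam]. Where th_k = 0,
   also a_k = lam_k = 0, and the default 0^-1 = 0 makes d_k = 0. *)
pose th k := D%:R * (a k / al + lam k).
have th0 k : 0 <= th k.
  by rewrite mulr_ge0 ?(ltW Dp)// addr_ge0// divr_ge0.
pose d k := (Num.sqrt (th k))^-1.
have d2 k : d k ^+ 2 = (th k)^-1 by rewrite exprVn sqr_sqrtr.
have d2a k : d k ^+ 2 * a k <= al / D%:R.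
  rewrite d2; have [->|tn] := eqVneq (th k) 0.
    by rewrite invr0 mul0r divr_ge0// ltW.
  have tp : 0 < th k by rewrite lt_neqAle eq_sym tn th0.
  rewrite ler_pdivrMl// mulrA ler_pdivlMr// /th.
  have -> : D%:R * (a k / al + lam k) * al =
    a k * D%:R + D%:R * lam k * al by field.
  by rewrite lerDl !mulr_ge0// ltW.
have d2lam k : lam k * d k ^+ 2 <= D%:R^-1.
  rewrite d2; have [->|tn] := eqVneq (th k) 0.
    by rewrite invr0 mulr0 invr_ge0 ltW.
  have tp : 0 < th k by rewrite lt_neqAle eq_sym tn th0.
  rewrite ler_pdivrMr// mulrA mulVf ?gt_eqF// mul1r lerDr.
  by rewrite divr_ge0.
pose dm : 'M[R]_N := diag_mx (\row_k d k).
have dmE (h : 'rV[R]_N) k : (h *m dm) 0 k = h 0 k * d k.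
  by rewrite /dm mul_mx_diag !mxE.
pose q (h : 'rV[R]_N) := \sum_k h 0 k ^+ 2.
have q0 h : 0 <= q h by apply: sumr_ge0 => k _; exact: sqr_ge0.
(* The cut at 3 makes the first term contribute exactly al/2 at the end. *)
pose op := al / D%:R / 3 + 3 * b.
have op0 : 0 <= op by rewrite addr_ge0 ?mulr_ge0 ?divr_ge0// ltW.
have nuop h : q h <= 1 -> nu (h *m dm) <= op.
  move=> qh; pose f := h *m dm.
  (* Where |f_k| > 3, one has |f_k| <= f_k^2 / 3 and d_k^2 a_k <= al/D. Elsewhere f/3 satisfies the
     two conditions under which nu is at most b. *)
  pose big : 'rV[R]_N := \row_k if 3 < `|f 0 k| then f 0 k else 0.
  pose small : 'rV[R]_N := \row_k if 3 < `|f 0 k| then 0 else f 0 k / 3.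
  have -> : h *m dm = big + 3 *: small.
    apply/rowP => k; rewrite !mxE -/(f 0 k); case: ifP => _.
      by rewrite mulr0 addr0.
    by rewrite add0r mulrC divfK.
  apply: (le_trans (nuD _ _)); rewrite nuZ ger0_norm//; apply: lerD.
    rewrite (row_sum_delta big); apply: (le_trans (seminorm_sum _ nuS)).
    have -> : al / D%:R / 3 = al / D%:R * 3^-1 * 1 by rewrite mulr1.
    apply: (@le_trans _ _ (al / D%:R / 3 * q h)); last first.
      by rewrite ler_wpM2l// !divr_ge0// ltW.
    rewrite mulr_sumr; apply: ler_sum => k _.
    rewrite nuZ -/(a k) mxE; case: ifP => [fk|_]; last first.
      by rewrite normr0 mul0r mulr_ge0 ?sqr_ge0// !divr_ge0// ltW.
    apply: (@le_trans _ _ (f 0 k ^+ 2 / 3 * a k)).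
      rewrite ler_wpM2r ?nu_ge0// -real_normK ?num_real// ler_pdivlMr//.
      by rewrite expr2 ler_wpM2l// ltW.
    rewrite /f dmE exprMn.
    have := ler_wpM2l (sqr_ge0 (h 0 k)) (d2a k).
    by move: (al / D%:R) => z; lra.
  rewrite ler_pM2l//; apply: nub => [k|].
    rewrite mxE; case: ltP => [_|h3]; first by rewrite normr0.
    by rewrite normrM normfV (ger0_norm (ltW (ltr0n _ 3))) ler_pdivrMr// mul1r.
  apply: (@le_trans _ _ (D%:R^-1 * q h)); last first.
    by rewrite ler_piMr// invr_ge0 ltW.
  rewrite mulr_sumr; apply: ler_sum => k _.
  apply: (@le_trans _ _ (lam k * f 0 k ^+ 2)).
    rewrite ler_wpM2l// mxE; case: ifP => _; first by rewrite expr0n sqr_ge0.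
    by have := sqr_ge0 (f 0 k); rewrite exprMn; lra.
  rewrite /f dmE exprMn mulrCA mulrC ler_wpM2r ?sqr_ge0//; exact: d2lam.
have nuop2 h : nu (h *m dm) <= op * Num.sqrt (q h).
  have [qz|qn] := eqVneq (q h) 0.
    have -> : h = 0.
      apply/rowP => k; rewrite mxE; move/eqP: qz.
      rewrite psumr_eq0 => [/allP/(_ k (mem_index_enum _))|? _]; last first.
        exact: sqr_ge0.
      by rewrite sqrf_eq0 => /eqP.
    by rewrite mul0mx seminorm0// mulr_ge0 ?sqrtr_ge0.
  have qp : 0 < Num.sqrt (q h) by rewrite sqrtr_gt0 lt_neqAle eq_sym qn q0.
  rewrite -ler_pdivrMr// mulrC -[X in X * _]ger0_norm ?invr_ge0 ?sqrtr_ge0//.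
  rewrite -nuZ scalemxAl; apply: nuop.
  rewrite {1}/q; under eq_bigr do rewrite mxE exprMn exprVn (sqr_sqrtr (q0 h)).
  by rewrite -mulr_sumr mulVf.
have [P [PT PP PB trP]] := orthogonal_projection (dm *m A).
have qP k : q (row k P) = P k k.
  rewrite /q -[in RHS]PP mxE; apply: eq_bigr => j _.
  by rewrite mxE expr2 -{2}PT mxE.
have anu k : a k <= op * ((th k + P k k) / 2).
  have nuk : nu (delta_mx 0 k *m dm) <= op * Num.sqrt (P k k).
    rewrite -qP.
    (* nu vanishes on the second summand, which [A] annihilates since P fixes the columns of
       [dm *m A]. *)
    have -> : delta_mx 0 k *m dm =
        row k P *m dm + (delta_mx 0 k - row k P) *m dm.
      by rewrite mulmxBl addrC subrK.
    apply: (le_trans (nuD _ _)); rewrite (nuA ((_ - _) *m dm)).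
      by rewrite addr0; exact: nuop2.
    by rewrite -mulmxA mulmxBl rowE -mulmxA PB subrr.
  have -> : a k = Num.sqrt (th k) * nu (delta_mx 0 k *m dm).
    have -> : delta_mx 0 k *m dm = d k *: delta_mx 0 k :> 'rV[R]_N.
      apply/rowP => j; rewrite dmE !mxE mulrC.
      by have [->|_] := eqVneq j k; rewrite ?andbF ?mulr0.
    rewrite nuZ -/(a k) ger0_norm ?invr_ge0 ?sqrtr_ge0// mulrA.
    have [tz|tn] := eqVneq (th k) 0; last first.
      by rewrite divff ?mul1r// sqrtr_eq0 -ltNge lt_neqAle eq_sym tn th0.
    rewrite tz sqrtr0 !mul0r; move/eqP: tz; rewrite mulf_eq0 gt_eqF//=.
    rewrite paddr_eq0 ?divr_ge0// mulf_eq0 invr_eq0 (negPf aln) orbF.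
    by move=> /andP[/eqP].
  apply: (le_trans (ler_wpM2l (sqrtr_ge0 _) nuk)); rewrite mulrCA ler_wpM2l//.
  have := sqr_ge0 (Num.sqrt (th k) - Num.sqrt (P k k)).
  have Pk : 0 <= P k k by rewrite -qP.
  have := sqr_sqrtr (th0 k); have := sqr_sqrtr Pk.
  by rewrite sqrrB; lra.
have thsum : \sum_k th k <= D%:R * 2.
  rewrite -mulr_sumr ler_pM2l// big_split/= -mulr_suml divff//.
  by have := lam1; lra.
have : al <= op * ((D%:R * 2 + D%:R) / 2).
  apply: (le_trans (ler_sum _ (fun k _ => anu k))).
  rewrite -mulr_sumr ler_wpM2l// -mulr_suml ler_pM2r// big_split/=.
  exact: lerD.
have -> : op * ((D%:R * 2 + D%:R) / 2) = al / 2 + 9 * D%:R * b / 2.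
  by rewrite /op; field; rewrite gt_eqF.
by rewrite -/al; lra.
Qed.

(** * Counting vectors *)

(** Merging the three cases lets the main estimate be proved once. *)
Definition number_of_vectors (R : realType) (r : R) (n : nat) : nat :=
  if r < 2 then n
  else if r == 2 then Num.truncn (n%:R * (1 + ln (n%:R : R)))
  else Num.truncn ((n%:R : R) `^ (r / 2)).

Lemma truncn_half_le (R : realType) (x : R) : 1 <= x ->
  x <= 2 * (Num.truncn x)%:R.
Proof.
move=> x1; have x0 : 0 <= x by apply: le_trans x1.
have t1 : (1 <= Num.truncn x)%N by rewrite truncn_ge_nat.
have := truncnS_gt x; rewrite -natr1 => h.
have : 1 <= (Num.truncn x)%:R :> R by rewrite ler1n.
by lra.
Qed.

Lemma nat_powR_ge (R : realType) (n : nat) (x : R) : (0 < n)%N -> 1 <= x ->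
  n%:R <= (n%:R : R) `^ x.
Proof. by move=> n0 x1; rewrite le1r_powR// ler1n. Qed.

(** Provides M > 0 and, for D = 2n, the condition D <= 2M of [seminorm_sum_powR_bound]. *)
Lemma number_of_vectors_ge (R : realType) (r : R) (n : nat) : (0 < n)%N ->
  (n <= number_of_vectors r n)%N.
Proof.
move=> n0; rewrite /number_of_vectors; case: ltP => // r2; case: eqP => _.
  rewrite truncn_ge_nat; last by rewrite mulr_ge0// addr_ge0// ln_ge0// ler1n.
  by rewrite ler_peMr// lerDl ln_ge0// ler1n.
rewrite truncn_ge_nat ?powR_ge0// nat_powR_ge//; lra.
Qed.

Lemma geometric_sum_lt1 (R : realType) (y : R) (L : nat) : 0 <= y -> y < 1 ->
  \sum_(i < L) y ^+ i <= (1 - y)^-1.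
Proof.
move=> y0 y1; have y1' : 0 < 1 - y by rewrite subr_gt0.
rewrite -[leRHS]mul1r ler_pdivlMr// mulrC -opprB mulNr -subrX1 opprB gerBl.
exact: exprn_ge0.
Qed.

Lemma geometric_sum_gt1 (R : realType) (y : R) (L : nat) : 1 < y ->
  \sum_(i < L) y ^+ i <= y ^+ L / (y - 1).
Proof.
move=> y1; have y1' : 0 < y - 1 by rewrite subr_gt0.
by rewrite ler_pdivlMr// mulrC -subrX1 gerBl.
Qed.

Lemma sqrt_double_le (R : realType) (r : R) (n : nat) : 0 < r -> r <= 2 ->
  (0 < n)%N -> Num.sqrt (n + n)%:R <= 2 * (n%:R : R) `^ r^-1.
Proof.
move=> r0 r2 n0; have n1 : 1 <= n%:R :> R by rewrite ler1n.
apply: (@le_trans _ _ (2 * Num.sqrt n%:R)).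
  have -> : 2 * Num.sqrt n%:R = Num.sqrt (2 ^+ 2 * n%:R) :> R.
    by rewrite sqrtrM ?exprn_ge0// sqrtr_sqr ger0_norm.
  by rewrite ler_sqrt ?mulr_ge0// -natrX -natrM ler_nat; lia.
rewrite ler_pM2l// -powR12_sqrt// ler_powR//.
by rewrite lef_pV2// posrE.
Qed.

(** The sum is geometric with ratio y = 2^(r - 2). It is bounded for r < 2, equals the number of
    levels, about log_4(2n), for r = 2, and has the order of its last term, about (2n)^(r/2 - 1),
    for r > 2. Multiplied by 2n, this is at most of the order of M. *)
Lemma level_count (R : realType) (r : R) : 1 < r ->
  exists2 K : R, 0 <= K & forall n, (0 < n)%N -> exists L : nat,
    [/\ (n + n <= 4 ^ L)%N,
        (n + n)%:R * \sum_(i < L) 2 `^ (i%:R * (r - 2)) <=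
          K * (number_of_vectors r n)%:R &
        Num.sqrt (n + n)%:R <= K * (number_of_vectors r n)%:R `^ r^-1].
Proof.
move=> r1; have r0 : 0 < r by apply: lt_trans r1.
pose y : R := 2 `^ (r - 2); have y0 : 0 < y by rewrite powR_gt0.
have yE L : \sum_(i < L) 2 `^ (i%:R * (r - 2)) = \sum_(i < L) y ^+ i.
  by apply: eq_bigr => i _; rewrite mulrC powRrM powR_mulrn// ltW.
(* [L.+1] is the least admissible number of levels; 4^L <= 2n keeps the sum short. *)
have levels n : (0 < n)%N -> exists L,
    (n + n <= 4 ^ L.+1)%N /\ (4 ^ L <= n + n)%N.
  move=> n0; have n2 : (1 < n + n)%N by lia.
  have /andP[h1 h2] := @up_log_bounds 4 (n + n) isT n2.
  exists (up_log 4 (n + n)).-1; split; last exact: ltnW.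
  by rewrite prednK// up_log_gt0.
rewrite /number_of_vectors; case: (ltgtP r 2) => r2.
- have y1 : y < 1.
    rewrite /y -[ltRHS](powRr0 2) /powR pnatr_eq0/= ltr_expR ltr_pM2r.
      by lra.
    by rewrite ln_gt0// ltr1n.
  exists (2 * (1 - y)^-1 + 2).
    by rewrite addr_ge0// mulr_ge0// invr_ge0 subr_ge0 ltW.
  move=> n n0; have [L [L1 _]] := levels n n0; exists L.+1; split => //.
    have -> : (n + n)%:R = 2 * n%:R :> R by rewrite natrD; ring.
    apply: (@le_trans _ _ (2 * n%:R * (1 - y)^-1)).
      by rewrite yE ler_wpM2l ?mulr_ge0// geometric_sum_lt1// ltW.
    by rewrite mulrAC ler_wpM2r// lerDl.
  apply: (le_trans (sqrt_double_le r0 (ltW r2) n0)).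
  rewrite ler_wpM2r ?powR_ge0// lerDr mulr_ge0// invr_ge0 subr_ge0.
  exact: ltW.
- have y1 : 1 < y.
    rewrite /y -[ltLHS](powRr0 2) /powR pnatr_eq0/= ltr_expR ltr_pM2r.
      by lra.
    by rewrite ln_gt0// ltr1n.
  have y1' : 0 < y - 1 by rewrite subr_gt0.
  (* The factor 2 pays for the integer part, 2^(r/2) for passing from n to 2n. *)
  pose c : R := 2 * 2 `^ (r / 2).
  have c1 : 1 <= c.
    have : 1 <= 2 `^ (r / 2) :> R.
      by rewrite -[leLHS](powRr0 2) ler_powR ?ler1n// divr_ge0// ltW.
    by rewrite /c; lra.
  have c0 : 0 <= c by apply: le_trans c1.
  have nM n : (0 < n)%N -> (n + n)%:R `^ (r / 2) <=
      c * (Num.truncn ((n%:R : R) `^ (r / 2)))%:R.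
    move=> n0; have -> : (n + n)%:R = 2 * n%:R :> R by rewrite natrD; ring.
    rewrite powRM// /c -mulrA mulrCA ler_pM2l ?powR_gt0//.
    apply: truncn_half_le; apply: le_trans (nat_powR_ge n0 _).
      by rewrite ler1n.
    by rewrite ler_pdivlMr// mul1r ltW.
  exists (c * (y / (y - 1)) + c).
    by rewrite addr_ge0// mulr_ge0// divr_ge0// ltW.
  move=> n n0; have [L [L1 L2]] := levels n n0; exists L.+1; split => //.
    set M := (Num.truncn _)%:R; have M0 : 0 <= M by exact: ler0n.
    rewrite yE mulrDl; apply: (@le_trans _ _ (c * (y / (y - 1)) * M)); last first.
      by rewrite lerDl mulr_ge0.
    have -> : c * (y / (y - 1)) * M = (y / (y - 1)) * (c * M) by ring.
    apply: (@le_trans _ _ (y / (y - 1) * (n + n)%:R `^ (r / 2))); last first.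
      by rewrite ler_wpM2l ?nM// divr_ge0// ltW.
    have n0' : 0 < (n + n)%:R :> R by rewrite ltr0n; lia.
    (* y^L = (4^L)^(r/2 - 1), and 4^L <= 2n. *)
    have yL : y ^+ L <= (n + n)%:R `^ (r / 2 - 1).
      apply: (@le_trans _ _ ((4 ^ L)%:R `^ (r / 2 - 1))); last first.
        by rewrite ge0_ler_powR ?nnegrE ?ler_nat//; lra.
      rewrite natrX -powR_mulrn ?(ltW y0)// -(powR_mulrn L)//.
      have -> : 4 = 2 `^ 2%:R :> R by rewrite powR_mulrn//; lra.
      by rewrite -!powRrM le_eqVlt; apply/orP; left; apply/eqP; congr powR; field.
    apply: (@le_trans _ _ ((n + n)%:R * (y ^+ L.+1 / (y - 1)))).
      by rewrite ler_pM2l// geometric_sum_gt1.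
    have -> : (n + n)%:R `^ (r / 2) = (n + n)%:R * (n + n)%:R `^ (r / 2 - 1) :> R.
      by rewrite mulr_powRB1// ?ltW// divr_gt0.
    have -> : (n + n)%:R * (y ^+ L.+1 / (y - 1)) =
        y / (y - 1) * ((n + n)%:R * y ^+ L) by rewrite exprS; ring.
    by rewrite ler_wpM2l ?ler_pM2l// divr_ge0// ltW.
  set M := (Num.truncn _)%:R; have M0 : 0 <= M by exact: ler0n.
  apply: (@le_trans _ _ (c * M `^ r^-1)); last first.
    by rewrite ler_wpM2r ?powR_ge0// lerDr mulr_ge0// divr_ge0// ltW.
  have -> : Num.sqrt (n + n)%:R = ((n + n)%:R `^ (r / 2)) `^ r^-1 :> R.
    rewrite -powRrM -powR12_sqrt//; congr powR; field.
    by rewrite gt_eqF.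
  apply: (@le_trans _ _ ((c * M) `^ r^-1)).
    by rewrite ge0_ler_powR ?nnegrE ?powR_ge0 ?mulr_ge0 ?invr_ge0 ?(ltW r0)// nM.
  rewrite powRM// ler_wpM2r ?powR_ge0// ler1_powR//.
  by rewrite invf_le1// ltW.
- have l4 : 0 < ln (4 : R) by rewrite ln_gt0// ltr1n.
  (* The factors pay for the integer part, for 2n in place of n, and for L + 1 <= (2 + 1/ln 4)(1 +
     ln n). *)
  pose c : R := 2 * (2 * (2 + (ln 4)^-1)).
  have c2 : 2 <= c.
    have : 0 < (ln (4 : R))^-1 by rewrite invr_gt0.
    by rewrite /c; lra.
  exists c; first by apply: le_trans c2.
  move=> n n0; have n1 : 1 <= n%:R :> R by rewrite ler1n.
  have ln0 : 0 <= ln (n%:R : R) by rewrite ln_ge0.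
  have M1 : n%:R * (1 + ln n%:R) <=
      2 * (Num.truncn (n%:R * (1 + ln n%:R) : R))%:R :> R.
    apply: truncn_half_le.
    by rewrite (le_trans n1)// ler_peMr ?ler0n// lerDl.
  have [L [L1 L2]] := levels n n0; exists L.+1; split => //.
    set M := (Num.truncn _)%:R in M1 *.
    have -> : \sum_(i < L.+1) 2 `^ (i%:R * (r - 2)) = L.+1%:R :> R.
      rewrite (eq_bigr (fun=> 1)) => [|i _]; first by rewrite sumr_const card_ord.
      by rewrite r2 subrr mulr0 powRr0.
    have Lle : L%:R * ln 4 <= ln 4 + ln (n%:R : R).
      rewrite -lnM ?posrE ?ltr0n// mulr_natl -lnXn ?ltr0n//.
      rewrite ler_ln ?posrE ?exprn_gt0 ?mulr_gt0 ?ltr0n//.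
      by rewrite -natrX -natrM ler_nat; lia.
    have Lle2 : L.+1%:R <= (2 + (ln 4)^-1) * (1 + ln (n%:R : R)).
      rewrite -ler_pdivlMr// in Lle; rewrite -natr1.
      have -> : (2 + (ln 4)^-1) * (1 + ln n%:R) =
        (ln 4 + ln n%:R) / ln 4 + 1 + (2 * ln n%:R + (ln 4)^-1) :> R.
        by field; rewrite gt_eqF.
      rewrite -[leLHS]addr0 lerD ?lerD2r//.
      by rewrite addr_ge0 ?mulr_ge0// invr_ge0 ltW.
    have -> : c * M = 2 * (2 + (ln 4)^-1) * (2 * M) by rewrite /c; ring.
    apply: (@le_trans _ _ (2 * (2 + (ln 4)^-1) * (n%:R * (1 + ln n%:R)))).
      2: by rewrite ler_wpM2l// mulr_ge0// addr_ge0// invr_ge0 ltW.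
    have -> : (n + n)%:R = 2 * n%:R :> R by rewrite natrD; ring.
    have -> : 2 * (2 + (ln 4)^-1) * (n%:R * (1 + ln n%:R)) =
      2 * n%:R * ((2 + (ln 4)^-1) * (1 + ln n%:R)) :> R by ring.
    by rewrite ler_wpM2l// mulr_ge0.
  have r2' : r <= 2 by rewrite r2.
  apply: (le_trans (sqrt_double_le r0 r2' n0)).
  apply: ler_pM => //; rewrite ?powR_ge0//.
  rewrite ge0_ler_powR ?nnegrE ?invr_ge0 ?(ltW r0)// ler_nat.
  have := number_of_vectors_ge r n0.
  by rewrite /number_of_vectors r2 ltxx eqxx.
Qed.

(** With a_k = nu(e_k), the indices split at lam_k = 1/M. Above it a_k^s <= (2 + s) lam_k. Below it
    a_k^s <= (2 + s)/M; as s - 1 = s/r, the product a_k^(s - 1) a_k is at most (2 + s) M^(-1/r) a_k,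
    and [sum_seminorm_bound] shows that the a_k have a sum of order M^(1/r). *)
Lemma seminorm_sum_powR_bound (R : realType) (s r K : R) (N D M L : nat)
    (nu : 'rV[R]_N -> R) (A : 'M[R]_(N, D)) :
  1 < s -> 1 < r -> s^-1 + r^-1 = 1 -> 0 <= K ->
  (0 < D)%N -> (0 < M)%N -> (D <= 2 * M)%N -> (D <= 4 ^ L)%N ->
  D%:R * \sum_(i < L) 2 `^ (i%:R * (r - 2)) <= K * M%:R ->
  Num.sqrt D%:R <= K * M%:R `^ r^-1 ->
  seminorm nu -> (forall x, x *m A = 0 -> nu x = 0) ->
  (forall f : 'I_M -> 'rV[R]_N, abs_sums_le1 f ->
     \sum_j nu (f j) `^ s <= 1) ->
  \sum_k nu (delta_mx 0 k) `^ s <=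
    (2 + s) * (1 + 9 * ((8 + 2 * s) * K `^ r^-1 + K)).
Proof.
move=> s1 r1 sr K0 D0 M0 DM DL DW sqD nuS nuA nuM.
have s0 : 0 < s by apply: lt_trans s1.
have r0 : 0 < r by apply: lt_trans r1.
have si0 : 0 <= s^-1 by rewrite invr_ge0 ltW.
have ri0 : 0 <= r^-1 by rewrite invr_ge0 ltW.
have Mp : 0 < M%:R :> R by rewrite ltr0n.
have Dp : 0 < D%:R :> R by rewrite ltr0n.
have nu_ge0 x : 0 <= nu x by apply: seminorm_ge0.
have [lam [lam0 lam1 lamP]] := pisier_measure s1 M0 nuS nuM.
(* The hypothesis is applied to g together with zeros; nu(g) > 1 would give nu(g)^s > 1. *)
have nu1 (g : 'rV[R]_N) : (forall k, `|g 0 k| <= 1) -> nu g <= 1.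
  move=> g1; rewrite leNgt; apply/negP => h.
  pose f (j : 'I_M) := if j == Ordinal M0 then g else 0.
  have fok : abs_sums_le1 f.
    move=> k; rewrite (bigD1 (Ordinal M0))//= big1 => [|j /negPf j0].
      by rewrite addr0 /f eqxx.
    by rewrite /f j0 mxE normr0.
  have := nuM f fok.
  rewrite (bigD1 (Ordinal M0))//= big1 => [|j /negPf j0].
    rewrite addr0 /f eqxx leNgt => /negP; apply.
    exact: lt_le_trans h (le1r_powR (ltW h) (ltW s1)).
  by rewrite /f j0 seminorm0// powR0// gt_eqF.
set W := \sum_(i < L) _ in DW.
have W0 : 0 <= W by apply: sumr_ge0 => i _; exact: powR_ge0.
(* This dominates [seminorm_level_bound] for e = 2/M: since 1/M <= 2/D, one has 2e <= 8/D, and D <=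
   4^L bounds 2^-L by D^(-1/2). *)
pose b : R := (8 + 2 * s) * (D%:R `^ (- s^-1) * W `^ r^-1) + (Num.sqrt D%:R)^-1.
have s8 : 1 <= 8 + 2 * s by lra.
have nub (g : 'rV[R]_N) : (forall k, `|g 0 k| <= 1) ->
    \sum_k lam k * g 0 k ^+ 2 <= D%:R^-1 -> nu g <= b.
  move=> g1 lamg; have e0 : 0 <= 2 / M%:R :> R by rewrite divr_ge0// ltW.
  apply: (le_trans (seminorm_level_bound L s1 r1 sr e0 nuS lam0 lamP nu1 g1)).
  have lamg0 : 0 <= \sum_k lam k * g 0 k ^+ 2.
    by apply: sumr_ge0 => k _; rewrite mulr_ge0 ?sqr_ge0.
  apply: lerD.
    rewrite [leRHS]mulrA ler_wpM2r ?powR_ge0// powRN.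
    have MD : M%:R^-1 <= 2 / D%:R :> R.
      rewrite ler_pdivlMr// mulrC ler_pdivrMr//.
      by rewrite -natrM ler_nat.
    apply: (@le_trans _ _ (((8 + 2 * s) / D%:R) `^ s^-1)).
      rewrite ge0_ler_powR ?nnegrE//.
      + by rewrite addr_ge0// mulr_ge0// mulr_ge0// ltW.
      + by rewrite divr_ge0// ?ltW//; lra.
      + rewrite [leRHS]mulrDl; apply: lerD; first by move: MD; lra.
        by rewrite ler_wpM2l// mulr_ge0// ltW.
    rewrite powRM ?invr_ge0 ?(ltW Dp)//; last by lra.
    rewrite -(powR_inv1 (ltW Dp)) -powRrM mulN1r powRN.
    by rewrite ler_wpM2r ?invr_ge0 ?powR_ge0// ler1_powR// invf_le1// ltW.
  rewrite exprVn lef_pV2 ?posrE ?exprn_gt0 ?sqrtr_gt0//.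
  have -> : 2 ^+ L = Num.sqrt (2 ^+ L ^+ 2) :> R.
    by rewrite sqrtr_sqr ger0_norm// exprn_ge0.
  rewrite ler_sqrt ?exprn_ge0// -exprM mulnC exprM -natrX -natrX ler_nat.
  by rewrite expnS expn1.
have := sum_seminorm_bound D0 nuS nuA lam0 lam1 nub.
set a := fun k => nu (delta_mx 0 k); rewrite -/(\sum_k a k) => aD.
have a0 k : 0 <= a k by exact: nu_ge0.
set T := (8 + 2 * s) * K `^ r^-1 + K.
have aT : \sum_k a k <= 9 * T * M%:R `^ r^-1.
  apply: (le_trans aD).
  rewrite -!mulrA ler_pM2l// mulrDr [leRHS]mulrDl; apply: lerD; last first.
    apply: le_trans sqD; rewrite le_eqVlt; apply/orP; left; apply/eqP.
    by rewrite -{1}(sqr_sqrtr (ltW Dp)) expr2 mulfK// gt_eqF// sqrtr_gt0.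
  rewrite mulrCA -mulrA; apply: ler_wpM2l; first by lra.
  have -> : D%:R * (D%:R `^ (- s^-1) * W `^ r^-1) = (D%:R * W) `^ r^-1.
    rewrite powRM ?(ltW Dp)// mulrA; congr (_ * _).
    rewrite -{1}(powRr1 (ltW Dp)) -powRD ?(gt_eqF Dp) ?implybT//.
    by congr powR; rewrite -sr; ring.
  by rewrite -powRM ?(ltW Mp)// ge0_ler_powR ?nnegrE ?mulr_ge0// ?ltW.
have delta1 k j : `|(delta_mx 0 k : 'rV[R]_N) 0 j| <= 1.
  by rewrite mxE /= normr_nat lern1 leq_b1.
have step k : a k `^ s <= (2 + s) * lam k + (2 + s) * M%:R `^ (- r^-1) * a k.
  have pk : a k `^ s <= 2 / M%:R + s * lam k.
    have := lamP _ (delta1 k).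
    rewrite (bigD1 k)//= big1 => [|j jk]; last first.
      by rewrite mxE (negPf jk) andbF normr0 mulr0.
    by rewrite mxE !eqxx normr1 mulr1 addr0.
  have [lamk|lamk] := leP (lam k) M%:R^-1; last first.
    rewrite -[leLHS]addr0 lerD//; first by move: pk lamk; lra.
    by rewrite !mulr_ge0 ?powR_ge0//; lra.
  rewrite -[leLHS]add0r lerD ?mulr_ge0//; first by lra.
  rewrite -mulr_powRB1// mulrC ler_wpM2r//.
  have -> : s - 1 = s * r^-1.
    have -> : r^-1 = 1 - s^-1 by rewrite -sr; ring.
    by field; rewrite gt_eqF.
  rewrite powRrM.
  apply: (@le_trans _ _ (((2 + s) / M%:R) `^ r^-1)).
    rewrite ge0_ler_powR ?nnegrE ?powR_ge0//.
      by rewrite divr_ge0// ?ltW//; lra.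
    by apply: (le_trans pk); rewrite [leRHS]mulrDl lerD2l ler_pM2l.
  rewrite powRM ?invr_ge0 ?(ltW Mp)//; last by lra.
  rewrite -(powR_inv1 (ltW Mp)) -powRrM mulN1r.
  rewrite ler_wpM2r ?powR_ge0// ler1_powR//; first by lra.
  by rewrite invf_le1// ltW.
apply: (le_trans (ler_sum _ (fun k _ => step k))).
rewrite big_split/= -!mulr_sumr -mulrA -mulrDr; apply: ler_wpM2l; first by lra.
apply: lerD => //.
have Mr : 0 < M%:R `^ r^-1 :> R by rewrite powR_gt0.
by rewrite powRN mulrC ler_pdivrMr.
Qed.

(** * Reduction to a seminorm on R^N *)

Definition real_scalar (R : realType) (F : scalars) : R -> scalar_field R F :=
  match F return R -> scalar_field R F with
  | RealScalars => fun a => a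
  | ComplexScalars => fun a => (a%:C)%C
  end.

Definition scalar_im (R : realType) (F : scalars) : scalar_field R F -> R :=
  match F return scalar_field R F -> R with
  | RealScalars => fun=> 0
  | ComplexScalars => fun z => complex.Im z
  end.

Lemma real_scalarD (R : realType) (F : scalars) (a b : R) :
  real_scalar F (a + b) = real_scalar F a + real_scalar F b.
Proof. by case: F => //=; exact: (rmorphD (real_complex R)). Qed.

Lemma real_scalarM (R : realType) (F : scalars) (a b : R) :
  real_scalar F (a * b) = real_scalar F a * real_scalar F b.
Proof. by case: F => //=; exact: (rmorphM (real_complex R)). Qed.

Lemma real_scalar1 (R : realType) (F : scalars) :
  real_scalar F 1 = 1 :> scalar_field R F.
Proof. by case: F. Qed.

Lemma real_scalar0 (R : realType) (F : scalars) :
  real_scalar F 0 = 0 :> scalar_field R F.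
Proof. by case: F. Qed.

Lemma real_scalar_comb_eq0 (R : realType) (F : scalars) (N : nat)
    (a : 'I_N -> R) (c : 'I_N -> scalar_field R F) :
  \sum_k a k * scalar_re (c k) = 0 -> \sum_k a k * scalar_im (c k) = 0 ->
  \sum_k real_scalar F (a k) * c k = 0.
Proof.
case: F c => //= c re0 im0.
have -> : \sum_k (a k)%:C%C * c k =
    Complex (\sum_k a k * complex.Re (c k)) (\sum_k a k * complex.Im (c k)).
  elim/big_ind3 : _ => // [x1 x2 _ y1 y2 _ -> ->//|k _].
  by case: (c k) => x y /=; simpc.
by rewrite re0 im0.
Qed.

Lemma rnorm_ge0 (R : realType) (F : scalars)
    (V : normedModType (scalar_field R F)) (x : V) : 0 <= rnorm x.
Proof.
rewrite /rnorm; case: F V x => //= V x.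
by have := normr_ge0 x; rewrite lecE => /andP[].
Qed.

Lemma rnormD (R : realType) (F : scalars)
    (V : normedModType (scalar_field R F)) (x y : V) :
  rnorm (x + y) <= rnorm x + rnorm y.
Proof.
rewrite /rnorm; case: F V x y => /= V x y; first exact: ler_normD.
have := ler_normD x y; rewrite lecE => /andP[_].
by case: `|x| => ? ?; case: `|y|.
Qed.

Lemma rnormZ (R : realType) (F : scalars)
    (V : normedModType (scalar_field R F)) (a : R) (x : V) :
  rnorm (real_scalar F a *: x) = `|a| * rnorm x.
Proof.
rewrite /rnorm; case: F V x => /= V x; rewrite normrZ//.
rewrite normc_def /= expr0n/= addr0 sqrtr_sqr.
by case: `|x| => u v /=; rewrite mul0r subr0.
Qed.

Lemma rnorm0 (R : realType) (F : scalars)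
    (V : normedModType (scalar_field R F)) : rnorm (0 : V) = 0.
Proof.
by have := rnormZ 0 (0 : V); rewrite scaler0 normr0 mul0r.
Qed.

Lemma rnorm_sum (R : realType) (F : scalars)
    (V : normedModType (scalar_field R F)) (I : finType) (x : I -> V) :
  rnorm (\sum_i x i) <= \sum_i rnorm (x i).
Proof.
elim/big_ind2 : _ => [|x1 x2 y1 y2 h1 h2|//]; first by rewrite rnorm0.
by apply: le_trans (rnormD _ _) _; rewrite lerD.
Qed.

Lemma seminorm_rnorm_comb (R : realType) (F : scalars)
    (V : normedModType (scalar_field R F)) (N : nat) (v : 'I_N -> V) (C : R) :
  0 <= C ->
  seminorm (fun a : 'rV[R]_N =>
    C * rnorm (\sum_k real_scalar F (a 0 k) *: v k)).
Proof.
move=> C0; split=> [x y|t x].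
  rewrite -mulrDr ler_wpM2l//; apply: le_trans (rnormD _ _).
  rewrite -big_split/= le_eqVlt; apply/orP; left; apply/eqP; congr rnorm.
  by apply: eq_bigr => k _; rewrite mxE real_scalarD scalerDl.
rewrite mulrCA -rnormZ scaler_sumr; congr (_ * rnorm _).
by apply: eq_bigr => k _; rewrite mxE real_scalarM scalerA.
Qed.

(* A complex n-dimensional range is spanned over the reals by 2n vectors. *)
Lemma rank_real_coordinates (R : realType) (F : scalars)
    (X Y : normedModType (scalar_field R F)) (T : {linear X -> Y}) (n N : nat)
    (x : 'I_N -> X) :
  has_rank T n -> exists A : 'M[R]_(N, n + n), forall a : 'rV[R]_N,
    a *m A = 0 -> \sum_k real_scalar F (a 0 k) *: T (x k) = 0.
Proof.
move=> [e [_ eT]].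
have /choice[c cP] : forall k, exists c : 'I_n -> scalar_field R F,
    \sum_i c i *: e i = T (x k).
  move=> k; have : range T (T (x k)) by exists (x k).
  by rewrite eT => -[c _ <-]; exists c.
(* Over the reals the block of imaginary parts is zero. *)
exists (row_mx (\matrix_(k, i) scalar_re (c k i))
               (\matrix_(k, i) scalar_im (c k i))) => a.
rewrite mul_mx_row -row_mx0 => /eq_row_mx[/rowP re0 /rowP im0].
under eq_bigr do rewrite -cP scaler_sumr.
rewrite exchange_big/= big1// => i _.
under eq_bigr do rewrite scalerA.
rewrite -scaler_suml real_scalar_comb_eq0 ?scale0r//.
  by have := re0 i; rewrite !mxE => h; rewrite -[RHS]h; apply: eq_bigr => k _; rewrite mxE.
by have := im0 i; rewrite !mxE => h; rewrite -[RHS]h; apply: eq_bigr => k _; rewrite mxE.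
Qed.

(** * Weakly summable families and summing norms *)

Lemma lp_norm_ge0 (R : realType) (p : \bar R) (m : nat) (a : 'I_m -> R) :
  0 <= lp_norm p a.
Proof.
case: p => [s| |] /=; first exact: powR_ge0.
  by elim/big_rec : _ => // i x _ x0; rewrite le_max x0 orbT.
by elim/big_rec : _ => // i x _ x0; rewrite le_max x0 orbT.
Qed.

Lemma powR_invM (R : realType) (x p : R) : 0 <= x -> p != 0 ->
  (x `^ p) `^ p^-1 = x.
Proof. by move=> x0 p0; rewrite -powRrM divff// powRr1. Qed.

Lemma powR_Minv (R : realType) (x p : R) : 0 <= x -> p != 0 ->
  (x `^ p^-1) `^ p = x.
Proof. by move=> x0 p0; rewrite -powRrM mulVf// powRr1. Qed.

Lemma powR_inv_le (R : realType) (p x y : R) : 0 < p -> 0 <= x -> 0 <= y ->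
  (x `^ p^-1 <= y) = (x <= y `^ p).
Proof.
move=> p0 x0 y0; have pn : p != 0 by rewrite gt_eqF.
apply/idP/idP => h.
  by rewrite -[leLHS](@powR_Minv _ _ p)// ge0_ler_powR ?nnegrE ?powR_ge0// ltW.
rewrite -[leRHS](@powR_invM _ _ p)// ge0_ler_powR ?nnegrE ?powR_ge0//.
by rewrite invr_ge0 ltW.
Qed.

Lemma weak_lp_norm_le1P (R : realType) (F : scalars)
    (X : normedModType (scalar_field R F)) (q : \bar R) (m : nat)
    (x : 'I_m -> X) :
  (weak_lp_norm q x <= 1)%E <->
  forall f : {linear X -> (scalar_field R F)^o}, (op_norm f <= 1)%E ->
    lp_norm q (fun k => rnorm (f (x k))) <= 1.
Proof.
split=> [h f f1|h].
  rewrite -lee_fin; apply: le_trans h; apply: ereal_sup_ubound.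
  by exists f.
by apply: ge_ereal_sup => _ [f /= f1 <-]; rewrite lee_fin h.
Qed.

Lemma summing_norm_on_ge0 (R : realType) (F : scalars)
    (X Y : normedModType (scalar_field R F)) (p q : \bar R) (m : nat)
    (T : {linear X -> Y}) : (0 < q)%E -> (0 <= summing_norm_on p q m T)%E.
Proof.
move=> q0; apply: (@le_trans _ _ (lp_norm p (fun k : 'I_m => rnorm (T 0)))%:E).
  by rewrite lee_fin lp_norm_ge0.
apply: ereal_sup_ubound; exists (fun=> 0) => //=.
apply/weak_lp_norm_le1P => f _.
rewrite linear0 rnorm0; case: q q0 => [s| |]//= s0.
  rewrite big1 => [|k _]; last by rewrite powR0// gt_eqF.
  by rewrite powR0// invr_neq0// gt_eqF.
by elim/big_ind : _ => // x y x0 y0; rewrite ge_max x0.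
Qed.

Lemma summing_norm_on_ub (R : realType) (F : scalars)
    (X Y : normedModType (scalar_field R F)) (p q : \bar R) (m : nat)
    (T : {linear X -> Y}) (C : R) (x : 'I_m -> X) :
  (summing_norm_on p q m T <= C%:E)%E -> (weak_lp_norm q x <= 1)%E ->
  lp_norm p (fun k => rnorm (T (x k))) <= C.
Proof.
move=> TC x1; rewrite -lee_fin; apply: le_trans TC.
by apply: ereal_sup_ubound; exists x.
Qed.

(* The extremal coefficients alpha turn the weakly q-summable family x into the
   weakly 1-summable family alpha x; a family of combinations of the latter is
   turned back into a weakly q-summable one by dividing by beta. *)
Lemma transferred_family_bound (R : realType) (F : scalars)
    (X Y : normedModType (scalar_field R F)) (T : {linear X -> Y})
    (p q s C : R) (m M : nat) (x : 'I_m -> X) (w : 'I_m -> R)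
    (f : 'I_M -> 'rV[R]_m) :
  1 <= q -> 0 < p -> 0 < s -> s^-1 = p^-1 + (1 - q^-1) ->
  0 <= C -> (summing_norm_on p%:E q%:E M T <= C%:E)%E ->
  (weak_lp_norm q%:E x <= 1)%E ->
  (forall k, 0 <= w k) -> \sum_k w k <= 1 -> abs_sums_le1 f ->
  \sum_j rnorm (\sum_k real_scalar F (f j 0 k) *:
     (real_scalar F (w k `^ (1 - q^-1)) *: T (x k))) `^ s <= C `^ s.
Proof.
move=> q1 p0 s0 spq C0 TC x1 w0 w1 f1.
have q0 : 0 < q by apply: lt_le_trans q1.
have qi0 : 0 < q^-1 by rewrite invr_gt0.
set ka : R := 1 - q^-1; have ka0 : 0 <= ka by rewrite subr_ge0 invf_le1.
pose W j : R := \sum_k `|f j 0 k| * w k.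
have W0 j : 0 <= W j by apply: sumr_ge0 => k _; rewrite mulr_ge0.
pose be j := W j `^ ka; have be0 j : 0 <= be j by exact: powR_ge0.
(* If be_j = 0, all the products f_jk w_k^ka vanish, so the default 0^-1 = 0 does no harm. *)
pose co j k := f j 0 k * w k `^ ka / be j.
have coE j k : f j 0 k * w k `^ ka = be j * co j k.
  have [bz|bn] := eqVneq (be j) 0; last by rewrite /co [RHS]mulrCA divff ?mulr1.
  rewrite bz mul0r; move/eqP: bz; rewrite powR_eq0 => /andP[Wz kn].
  move: Wz; rewrite psumr_eq0 => [/allP/(_ k (mem_index_enum _))|i _]; last first.
    by rewrite mulr_ge0.
  rewrite /= mulf_eq0 normr_eq0 => /orP[/eqP ->|/eqP ->]; first by rewrite mul0r.
  by rewrite powR0// mulr0.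
pose y j : X := \sum_k real_scalar F (co j k) *: x k.
(* Hoelder against W_j gives |phi(y_j)|^q <= sum_k |f_jk| |phi(x_k)|^q; the sum over j then uses
   sum_j |f_jk| <= 1. *)
have y1 : (weak_lp_norm q%:E y <= 1)%E.
  apply/weak_lp_norm_le1P => phi phi1.
  have /weak_lp_norm_le1P/(_ phi phi1) /= := x1.
  set z := fun k => rnorm (phi (x k)).
  have z0 k : 0 <= z k by exact: rnorm_ge0.
  have zs0 : 0 <= \sum_k z k `^ q by apply: sumr_ge0 => k _; exact: powR_ge0.
  rewrite powR_inv_le// powR1 => z1.
  have ys0 : 0 <= \sum_j rnorm (phi (y j)) `^ q.
    by apply: sumr_ge0 => k _; exact: powR_ge0.
  rewrite powR_inv_le// powR1; apply: le_trans z1.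
  apply: (@le_trans _ _ (\sum_j \sum_k `|f j 0 k| * z k `^ q)); last first.
    rewrite exchange_big/=; apply: ler_sum => k _.
    by rewrite -mulr_suml ler_piMl ?powR_ge0.
  apply: ler_sum => j _.
  have Z0 : 0 <= \sum_k `|f j 0 k| * z k `^ q.
    by apply: sumr_ge0 => k _; rewrite mulr_ge0 ?powR_ge0.
  rewrite -[leRHS](@powR_Minv _ _ q) ?gt_eqF//.
  rewrite ge0_ler_powR ?nnegrE ?rnorm_ge0 ?powR_ge0// ?(ltW q0)//.
  have yz : rnorm (phi (y j)) <= (\sum_k `|f j 0 k| * w k `^ ka * z k) / be j.
    rewrite linear_sum; apply: (le_trans (rnorm_sum _)).
    rewrite mulr_suml; apply: ler_sum => k _.
    rewrite linearZ_LR rnormZ -/(z k) /co !normrM normfV.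
    rewrite (ger0_norm (be0 j)) (ger0_norm (powR_ge0 _ _)).
    by rewrite mulrAC.
  apply: (le_trans yz).
  have [->|bn] := eqVneq (be j) 0; first by rewrite invr0 mulr0 powR_ge0.
  rewrite ler_pdivrMr ?lt_neqAle 1?eq_sym ?bn ?be0// mulrC.
  have kq : ka + q^-1 = 1 by rewrite subrK.
  have u0 k : 0 <= `|f j 0 k| * w k by rewrite mulr_ge0.
  have v0 k : 0 <= `|f j 0 k| * z k `^ q by rewrite mulr_ge0 ?powR_ge0.
  apply: le_trans (holder_sum ka0 (ltW qi0) kq u0 v0).
  apply: ler_sum => k _; rewrite !powRM ?powR_ge0// powR_invM ?gt_eqF//.
  by rewrite mulrACA -powRD ?kq ?oner_eq0// powRr1// mulrA.
have := summing_norm_on_ub TC y1; rewrite /=.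
set t := fun j => rnorm (T (y j)).
have t0 j : 0 <= t j by exact: rnorm_ge0.
have ts0 : 0 <= \sum_j t j `^ p by apply: sumr_ge0 => k _; exact: powR_ge0.
move=> tC.
(* The given combination is be_j times T(y_j). Hoelder with exponents ka s and s/p separates the
   W_j, of sum at most 1, from the norms of the T(y_j). *)
have -> : \sum_j rnorm (\sum_k real_scalar F (f j 0 k) *:
     (real_scalar F (w k `^ ka) *: T (x k))) `^ s =
   \sum_j W j `^ (ka * s) * (t j `^ p) `^ (s / p).
  apply: eq_bigr => j _; rewrite -powRrM.
  have -> : p * (s / p) = s by field; rewrite gt_eqF.
  rewrite powRrM -powRM ?powR_ge0//; congr (_ `^ _); rewrite -/(be j) /t.
  rewrite -[X in X * _]ger0_norm// -rnormZ /y linear_sum scaler_sumr.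
  congr rnorm; apply: eq_bigr => k _.
  by rewrite [T (_ *: x k)]linearZ_LR !scalerA -!real_scalarM coE.
have ks : ka * s + s / p = 1.
  have -> : ka = s^-1 - p^-1 by rewrite spq /ka; ring.
  by field; rewrite !gt_eqF.
have kas0 : 0 <= ka * s by rewrite mulr_ge0// ltW.
have sp0 : 0 <= s / p by rewrite divr_ge0// ltW.
have tp0 j : 0 <= t j `^ p by exact: powR_ge0.
apply: (le_trans (holder_sum kas0 sp0 ks W0 tp0)).
rewrite -[leRHS]mul1r; apply: ler_pM; rewrite ?powR_ge0//.
  have -> : 1 = 1 `^ (ka * s) :> R by rewrite powR1.
  rewrite ge0_ler_powR ?nnegrE//; first exact: sumr_ge0.
  rewrite /W exchange_big/=; apply: le_trans w1; apply: ler_sum => k _.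
  by rewrite -mulr_suml ler_piMl.
by rewrite mulrC powRrM ge0_ler_powR ?nnegrE ?powR_ge0// ltW.
Qed.

(** A bound C > 0 replaces the norm on M vectors, so that the seminorm can be divided by C even if
    that norm is 0. *)
Lemma summing_norm_few_vectors_fin (R : realType) (r : R) : 1 < r ->
  exists2 c : R, 0 < c & forall p q : R,
    1 <= q -> q <= p -> q^-1 = p^-1 + r^-1 ->
    forall n, (0 < n)%N -> forall (F : scalars)
      (X Y : normedModType (scalar_field R F)) (T : {linear X -> Y}),
      has_rank T n -> forall C : R, 0 < C ->
      (summing_norm_on p%:E q%:E (number_of_vectors r n) T <= C%:E)%E ->
      (summing_norm p%:E q%:E T <= (c * C)%:E)%E.
Proof.
move=> r1; have r0 : 0 < r by apply: lt_trans r1.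
have [K K0 KP] := level_count r1.
pose s := (1 - r^-1)^-1.
have ri1 : r^-1 < 1 by rewrite invf_lt1.
have ri0 : 0 < r^-1 by rewrite invr_gt0.
have s1 : 1 < s by rewrite invf_gt1 ?subr_gt0// gtrBl.
have s0 : 0 < s by apply: lt_trans s1.
have sr : s^-1 + r^-1 = 1 by rewrite invrK subrK.
pose B := (2 + s) * (1 + 9 * ((8 + 2 * s) * K `^ r^-1 + K)).
have B0 : 0 <= B.
  rewrite mulr_ge0// ?addr_ge0 ?(ltW s0)// mulr_ge0// addr_ge0//.
  by rewrite mulr_ge0 ?powR_ge0// addr_ge0// mulr_ge0// ltW.
(* The summand 1 only makes the constant positive. *)
exists (1 + B `^ s^-1); first by rewrite ltr_pwDl ?powR_ge0.
move=> p q q1 qp qpr n n0 F X Y T rkT C C0 TC.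
have q0 : 0 < q by apply: lt_le_trans q1.
have p0 : 0 < p by apply: lt_le_trans qp.
have pn : p != 0 by rewrite gt_eqF.
set M := number_of_vectors r n in TC.
have nM : (n <= M)%N by exact: number_of_vectors_ge.
have M0 : (0 < M)%N by exact: leq_trans nM.
apply: ge_ereal_sup => _ [m _ <-].
apply: ge_ereal_sup => _ [x /= x1 <-]; rewrite lee_fin.
apply: (@le_trans _ _ (B `^ s^-1 * C)); last by rewrite ler_pM2r// lerDr.
set t := fun k => rnorm (T (x k)).
have t0 k : 0 <= t k by exact: rnorm_ge0.
pose Th := \sum_k t k `^ p; rewrite -/Th.
have Th0 : 0 <= Th by apply: sumr_ge0 => k _; exact: powR_ge0.
have [Thz|Thn] := eqVneq Th 0.
  by rewrite Thz powR0 ?invr_neq0// mulr_ge0 ?powR_ge0// ltW.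
have Thp : 0 < Th by rewrite lt_neqAle eq_sym Thn.
(* Extremal weights in Hoelder's inequality: the s-th powers of w_k^ka t_k are proportional to
   t_k^p. *)
pose w k := t k `^ p / Th.
have w0 k : 0 <= w k by rewrite divr_ge0 ?powR_ge0.
have w1 : \sum_k w k <= 1 by rewrite -mulr_suml divff.
have spq : s^-1 = p^-1 + (1 - q^-1) by rewrite invrK qpr; ring.
set ka := 1 - q^-1 in spq.
have ka0 : 0 <= ka by rewrite subr_ge0 invf_le1.
pose v k := real_scalar F (w k `^ ka) *: T (x k).
pose nu (a : 'rV[R]_m) := C^-1 * rnorm (\sum_k real_scalar F (a 0 k) *: v k).
have nuS : seminorm nu by apply: seminorm_rnorm_comb; rewrite invr_ge0 ltW.
have [A AP] := rank_real_coordinates x rkT.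
have [L [L1 L2 L3]] := KP n n0.
pose al := diag_mx (\row_k w k `^ ka) : 'M[R]_m.
have nuA (a : 'rV[R]_m) : a *m (al *m A) = 0 -> nu a = 0.
  rewrite mulmxA => /AP h; rewrite /nu.
  suff -> : \sum_k real_scalar F (a 0 k) *: v k = 0 by rewrite rnorm0 mulr0.
  rewrite -[RHS]h; apply: eq_bigr => k _.
  by rewrite /v scalerA -real_scalarM /al mul_mx_diag !mxE.
have nuM (f : 'I_M -> 'rV[R]_m) : abs_sums_le1 f -> \sum_j nu (f j) `^ s <= 1.
  move=> f1.
  have := transferred_family_bound q1 p0 s0 spq (ltW C0) TC x1 w0 w1 f1.
  rewrite -/ka => h; rewrite /nu.
  under eq_bigr do rewrite powRM ?rnorm_ge0 ?invr_ge0 ?(ltW C0)//.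
  rewrite -mulr_sumr -(powR_inv1 (ltW C0)) powRAC powR_inv1 ?powR_ge0//.
  by rewrite ler_pdivrMl ?powR_gt0// mulr1.
have nn0 : (0 < n + n)%N by rewrite addn_gt0 n0.
have nnM : (n + n <= 2 * M)%N by rewrite mul2n -addnn leq_add.
have := seminorm_sum_powR_bound s1 r1 sr K0 nn0 M0 nnM L1 L2 L3 nuS nuA nuM.
rewrite -/B.
have nue k : nu (delta_mx 0 k) = C^-1 * (w k `^ ka * t k).
  rewrite /nu (bigD1 k)//= big1 => [|j jk]; last first.
    by rewrite mxE (negPf jk) andbF real_scalar0 scale0r.
  rewrite addr0 mxE !eqxx real_scalar1 scale1r rnormZ ger0_norm//.
  exact: powR_ge0.
have nues k : nu (delta_mx 0 k) `^ s = C^-1 `^ s * (t k `^ p * Th `^ (- (ka * s))).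
  rewrite nue powRM ?invr_ge0 ?(ltW C0) ?mulr_ge0 ?powR_ge0//; congr (_ * _).
  have -> : w k `^ ka = t k `^ (p * ka) * Th `^ (- ka).
    by rewrite /w powRM ?powR_ge0 ?invr_ge0// powRrM -(powR_inv1 Th0)
      -(powRrM Th) mulN1r.
  rewrite !powRM ?mulr_ge0 ?powR_ge0// -!powRrM -mulNr mulrAC; congr (_ * _).
  have ks : p * ka * s + s = p.
    have -> : ka = s^-1 - p^-1 by rewrite spq; ring.
    by field; rewrite pn gt_eqF.
  by rewrite -powRD ks// (negPf pn).
under eq_bigr do rewrite nues.
rewrite -mulr_sumr -mulr_suml -/Th.
rewrite -(powR_inv1 (ltW C0)) powRAC powR_inv1 ?powR_ge0//.
rewrite ler_pdivrMl ?powR_gt0//.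
(* Since 1 - ka s = s/p, the bound on the sum of the nu(e_k)^s reads Th^(s/p) <= B C^s. *)
have -> : Th * Th `^ (- (ka * s)) = Th `^ (p^-1 * s).
  rewrite -{1}(powRr1 Th0) -powRD ?Thn ?implybT//; congr powR.
  have -> : ka = s^-1 - p^-1 by rewrite spq; ring.
  by field; rewrite pn gt_eqF.
rewrite powRrM => h.
rewrite -(@powR_invM _ (Th `^ p^-1) s) ?powR_ge0 ?gt_eqF//.
rewrite -[X in _ <= _ * X](@powR_invM _ C s) ?(ltW C0) ?gt_eqF//.
rewrite -powRM ?powR_ge0//.
rewrite mulrC in h.
have si0 : 0 <= s^-1 by rewrite invr_ge0 ltW.
have BC0 : 0 <= B * C `^ s by rewrite mulr_ge0 ?powR_ge0.
by apply: ge0_ler_powR => //; rewrite nnegrE powR_ge0.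
Qed.

(** * The exponent p = infinity and the final assembly *)

Lemma summing_norm_infty_le (R : realType) (F : scalars)
    (X Y : normedModType (scalar_field R F)) (T : {linear X -> Y})
    (q : R) (M : nat) :
  0 < q -> (0 < M)%N ->
  (summing_norm +oo q%:E T <= summing_norm_on +oo q%:E M T)%E.
Proof.
move=> q0 M0; apply: ge_ereal_sup => _ [m _ <-].
apply: ge_ereal_sup => _ [x /= x1 <-].
have TM0 := @summing_norm_on_ge0 R F X Y +oo q%:E M T q0.
suff h k : ((rnorm (T (x k)))%:E <= summing_norm_on +oo q%:E M T)%E.
  by elim/big_rec : _ => // k a _ aT; rewrite EFin_max ge_max h.
(* A maximum is governed by one vector at a time, which is placed here among M - 1 zeros. *)
pose j0 := Ordinal M0.
pose y (j : 'I_M) := if j == j0 then x k else 0.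
have y1 : (weak_lp_norm q%:E y <= 1)%E.
  apply/weak_lp_norm_le1P => phi phi1.
  have /weak_lp_norm_le1P/(_ phi phi1) /= := x1.
  apply: le_trans; rewrite ge0_ler_powR ?nnegrE ?invr_ge0 ?(ltW q0)//.
  - by apply: sumr_ge0 => j _; exact: powR_ge0.
  - by apply: sumr_ge0 => j _; exact: powR_ge0.
  rewrite (bigD1 j0)//= big1 => [|j /negPf jj]; last first.
    by rewrite /y jj linear0 rnorm0 powR0// gt_eqF.
  rewrite /y eqxx addr0 (bigD1 k)//= lerDl.
  by apply: sumr_ge0 => j _; exact: powR_ge0.
apply: (@le_trans _ _ (lp_norm +oo (fun j => rnorm (T (y j))))%:E); last first.
  by apply: ereal_sup_ubound; exists y.
by rewrite lee_fin /= (bigD1 j0)//= /y eqxx le_max lexx.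
Qed.

(** For finite b, C = b + e/c is positive even if b = 0, and e > 0 is arbitrary; for infinite b the
    right side is infinite. *)
Lemma lee_pM_of_gt (R : realType) (c : R) (a b : \bar R) : 0 < c ->
  (0 <= b)%E ->
  (forall C : R, 0 < C -> (b <= C%:E)%E -> (a <= (c * C)%:E)%E) ->
  (a <= c%:E * b)%E.
Proof.
move=> c0; case: b => [b| |]//= b0 h.
  apply/lee_addgt0Pr => e e0; rewrite -EFinM -EFinD.
  have ec : 0 < e / c by rewrite divr_gt0.
  have -> : c * b + e = c * (b + e / c) by field; rewrite gt_eqF.
  apply: h; first by rewrite ltr_wpDl// -lee_fin.
  by rewrite lee_fin lerDl ltW.
by rewrite gt0_muley ?lte_fin// leey.
Qed.

Lemma summing_norm_few_vectors (R : realType) (r : R) : 1 <= r ->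
  exists c : R, forall p q : \bar R,
    (1 <= q)%E -> (q <= p)%E -> (q <= r%:E)%E ->
    (q^-1 = p^-1 + (r%:E)^-1)%E ->
    forall n, (0 < n)%N -> forall (F : scalars)
      (X Y : normedModType (scalar_field R F)) (T : {linear X -> Y}),
      has_rank T n ->
      (summing_norm p q T <=
       c%:E * summing_norm_on p q (number_of_vectors r n) T)%E.
Proof.
move=> r1; have r0 : 0 < r by apply: lt_le_trans r1.
have [c [c1 cP]] : exists c : R, 1 <= c /\ forall p q : R,
    1 <= q -> q <= p -> q^-1 = p^-1 + r^-1 ->
    forall n, (0 < n)%N -> forall (F : scalars)
      (X Y : normedModType (scalar_field R F)) (T : {linear X -> Y}),
      has_rank T n ->
      (summing_norm p%:E q%:E T <=
       c%:E * summing_norm_on p%:E q%:E (number_of_vectors r n) T)%E.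
  (* For r = 1 a finite p would give 1/q = 1/p + 1 > 1. *)
  have [rgt|rle] := ltP 1 r; last first.
    exists 1; split=> // p q q1 qp.
    have -> : r = 1 by apply/le_anti; rewrite rle r1.
    have p0 : 0 < p^-1 by rewrite invr_gt0 (lt_le_trans _ qp)// (lt_le_trans _ q1).
    have : q^-1 <= 1 by rewrite invf_le1// (lt_le_trans _ q1).
    by rewrite invr1 => h e; exfalso; move: h; rewrite e gerDr leNgt p0.
  have [c c0 cP] := summing_norm_few_vectors_fin rgt.
  (* A constant at least 1 also covers p = infinity. *)
  exists (c + 1); split; first by rewrite lerDr ltW.
  move=> p q q1 qp e n n0 F X Y T rkT.
  have q0 : (0 < q%:E)%E by rewrite lte_fin (lt_le_trans _ q1).
  apply: (@le_trans _ _ (c%:E * summing_norm_on p%:E q%:E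
      (number_of_vectors r n) T)%E).
    apply: lee_pM_of_gt => //; first exact: summing_norm_on_ge0.
    by move=> C C0; apply: cP q1 qp e n n0 F X Y T rkT C C0.
  by rewrite lee_wpmul2r ?summing_norm_on_ge0// lee_fin lerDl.
exists c => p q; case: q => [q| |]//; rewrite lee_fin => q1.
have q0 : 0 < q by apply: lt_le_trans q1.
case: p => [p| |]//.
  rewrite !lee_fin => qp _; have p0 : 0 < p by apply: lt_le_trans qp.
  rewrite !inver !gt_eqF// => -[e] n n0 F X Y T rkT.
  exact: cP.
move=> _ _ _ n n0 F X Y T rkT.
have M0 : (0 < number_of_vectors r n)%N.
  exact: leq_trans (number_of_vectors_ge r n0).
apply: (le_trans (summing_norm_infty_le T q0 M0)).
by rewrite lee_pemull ?summing_norm_on_ge0.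
Qed.

Local Open Scope ereal_scope.

Theorem theorem1 (R : realType) (r : \bar R) :
  exists c : R, forall (p q : \bar R),
    1 <= q -> q <= p -> p <= +oo -> q <= r -> r <= +oo ->
    q^-1 = p^-1 + r^-1 ->
    forall (n : nat), (0 < n)%N ->
    forall (F : scalars) (X Y : completeNormedModType (scalar_field R F))
      (T : {linear X -> Y}),
      bounded_near T (nbhs (0%R : X)) ->
      has_rank T n ->
      [/\ 1 <= r < 2%:E ->
            summing_norm p q T <= c%:E * summing_norm_on p q n T,
          r = 2%:E ->
            summing_norm p q T <=
            c%:E * summing_norm_on p q (Num.truncn (n%:R * (1 + ln (n%:R : R)))%R) T
        & 2%:E < r < +oo ->
            summing_norm p q T <=
            c%:E * summing_norm_on p q (Num.truncn ((n%:R : R) `^ (fine r / 2))%R) T].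
Proof.
(* For infinite r none of the three cases applies. *)
case: r => [r| |]; last 2 first.
- by exists 0%R => p q *; split => // /andP[].
- by exists 0%R => p q *; split => // /andP[].
(* r < 1 contradicts 1 <= q <= r. *)
have [r1|r1] := leP 1%R r; last first.
  exists 0%R => p q q1 qp _ qr.
  by have := le_trans q1 qr; rewrite lee_fin leNgt r1.
have [c cP] := summing_norm_few_vectors r1.
exists c => p q q1 qp _ qr _ e n n0 F X Y T _ rkT.
have this := cP p q q1 qp qr e n n0 F X Y T rkT.
rewrite /number_of_vectors in this; split.
- by move=> /andP[_]; rewrite lte_fin => r2; move: this; rewrite r2.
- by move=> [r2]; move: this; rewrite r2 ltxx eqxx.
- move=> /andP[]; rewrite lte_fin => r2 _; move: this.
  by rewrite ltNge (ltW r2)/= gt_eqF.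
Qed.
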